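(* For any $M>0$ there exists $u\in\dot H^{1/2}(\mathbb{R};\mathbb{S})$ with $\deg u=2$ such that $$\inf_{\vartheta\in\mathbb{S},\ \vec\alpha\in\mathbb{H}^2}\|u-\psi_{\vartheta,\vec\alpha}\|_{\dot H^{1/2}(\mathbb{R})}^2\geq M\big(\|u\|_{\dot H^{1/2}(\mathbb{R})}^2-2\big),$$ where, for $\vec\alpha=(\alpha_1,\alpha_2)$, $\psi_{\vartheta,\vec\alpha}(x)=e^{\mathrm{i}\vartheta}\frac{x-\alpha_1}{x-\bar\alpha_1}\cdot\frac{x-\alpha_2}{x-\bar\alpha_2}$.
   Context: $\mathbb{S}\subset\mathbb{C}$ is the unit circle and $\mathbb{H}=\{z\in\mathbb{C}:\operatorname{Im}z>0\}$. In $\psi_{\vartheta,\vec\alpha}$ the parameter $\vartheta\in\mathbb{S}$ is understood as an angle modulo $2\pi$, so that $e^{\mathrm{i}\vartheta}$ ranges over the unit circle. $\|f\|_{\dot H^{1/2}(\mathbb{R})}^2=\frac1{4\pi^2}\iint_{\mathbb{R}\times\mathbb{R}}\frac{|f(x)-f(y)|^2}{|x-y|^2}dxdy$, and $\dot H^{1/2}(\mathbb{R};\mathbb{S})$ is the set of measurable $u:\mathbb{R}\to\mathbb{C}$ with $|u|=1$ a.e. and $\|u\|_{\dot H^{1/2}(\mathbb{R})}<\infty$. Degree: for $w:\mathbb{S}\to\mathbb{S}$ in $\dot H^{1/2}$ with Fourier expansion $w=\sum_{k\in\mathbb{Z}}c_kz^k$, $\deg w=\sum_{k\in\mathbb{Z}}k|c_k|^2$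 (the winding number, an integer). For $u\in\dot H^{1/2}(\mathbb{R};\mathbb{S})$, $\deg u:=\deg(u\circ\mathcal{S}^{-1})$, with the stereographic projection $\mathcal{S}(x)=\big(\frac{2x}{x^2+1},\frac{x^2-1}{x^2+1}\big)$ from $\mathbb{R}$ to $\mathbb{S}$. *)

(* Defs.v *)
From HB Require Import structures.
From mathcomp Require Import all_boot all_order all_algebra.
From mathcomp Require Import all_classical all_reals all_analysis.
From mathcomp Require Import complex ring lra.

Set Implicit Arguments.
Unset Strict Implicit.
Unset Printing Implicit Defensive.

Import Order.TTheory GRing.Theory Num.Theory.
Import numFieldNormedType.Exports.

Local Open Scope classical_set_scope.
Local Open Scope ring_scope.
Local Open Scope complex_scope.

Section Definitions.
Variable R : realType.
Local Notation C := R[i].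
Local Notation mu := (@lebesgue_measure R).

(* The modulus as an element of R; `|z| would live in R[i]. *)
Definition cabs (z : C) : R := ComplexField.Normc.normc z.

Definition cmeasurable (f : R -> C) : Prop :=
  measurable_fun [set: R] (fun x => complex.Re (f x)) /\
  measurable_fun [set: R] (fun x => complex.Im (f x)).

Definition cintegral (D : set R) (f : R -> C) : C :=
  Rintegral mu D (fun x => complex.Re (f x)) +i*
  Rintegral mu D (fun x => complex.Im (f x)).

(* e^{it} *)
Definition cis (t : R) : C := cos t +i* sin t.

(* On the diagonal, which is negligible, the integrand is 0 since 0^-1 = 0. *)
Definition Hhalf_sqnorm (f : R -> C) : \bar R :=
  (((4 * pi ^+ 2)^-1)%:E *
   \int[(mu \x mu)%E]_z
     ((cabs (f z.1 - f z.2) ^+ 2) / (`|z.1 - z.2| ^+ 2))%:E)%E.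

Definition HhalfS (u : R -> C) : Prop :=
  [/\ cmeasurable u,
      {ae mu, forall x, cabs (u x) = 1} &
      (Hhalf_sqnorm u < +oo)%E].

(* Functions on the unit circle are represented by functions on C, of which
   only the values on the circle matter. *)
Definition fourier_coef (w : C -> C) (k : int) : C :=
  ((2 * pi)^-1)%:C *
  cintegral `[0, 2 * pi]%classic (fun t => w (cis t) * cis (- (k%:~R * t))).

(* The sum over k in int of a real family, as the difference of the sums of
   its positive and negative parts. *)
Definition int_sum (a : int -> R) : \bar R :=
  (\esum_(k in [set: int]) (Num.max (a k) 0)%:E -
   \esum_(k in [set: int]) (Num.max (- a k) 0)%:E)%E.

Definition deg_circle (w : C -> C) : \bar R :=
  int_sum (fun k => k%:~R * cabs (fourier_coef w k) ^+ 2).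

Definition stereo (x : R) : C :=
  (2 * x / (x ^+ 2 + 1)) +i* ((x ^+ 2 - 1) / (x ^+ 2 + 1)).

(* Junk value 0 at the north pole 'i, see stereoK and stereo_invK. *)
Definition stereo_inv (z : C) : R := complex.Re z / (1 - complex.Im z).

Definition deg_line (u : R -> C) : \bar R :=
  deg_circle (fun z => u (stereo_inv z)).

Definition upper_half : set C := [set a | 0 < complex.Im a].

Definition psi (theta : R) (a : C * C) (x : R) : C :=
  cis theta * ((x%:C - a.1) / (x%:C - conjc a.1)) *
  ((x%:C - a.2) / (x%:C - conjc a.2)).

Lemma stereoK : cancel stereo stereo_inv.
Proof.
move=> x; rewrite /stereo_inv /=.
have d0 : x ^+ 2 + 1 != 0 by rewrite gt_eqF// ltr_wpDl// sqr_ge0.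
rewrite (_ : 1 - _ = 2 / (x ^+ 2 + 1)); last by field.
by field.
Qed.

Lemma stereo_invK (z : C) :
  cabs z = 1 -> z != 0 +i* 1 -> stereo (stereo_inv z) = z.
Proof.
case: z => a b; rewrite /cabs /= => /(congr1 (fun r => r ^+ 2)).
rewrite sqr_sqrtr ?addr_ge0 ?sqr_ge0// expr1n => ab1 zN.
have b1 : 1 - b != 0.
  rewrite subr_eq0; apply: contra zN => /eqP b1; move: ab1.
  rewrite -b1 expr1n => /(canRL (addrK _)); rewrite subrr => /eqP.
  by rewrite sqrf_eq0 => /eqP ->.
have a2 : a ^+ 2 = (1 - b) * (1 + b) by rewrite -[X in X = _](addrK (b ^+ 2)) ab1; ring.
rewrite /stereo /stereo_inv /= expr_div_n a2.
have -> : (1 - b) * (1 + b) / (1 - b) ^+ 2 = (1 + b) / (1 - b) by field.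
have -> : (1 + b) / (1 - b) + 1 = 2 / (1 - b) by field.
have -> : (1 + b) / (1 - b) - 1 = 2 * b / (1 - b) by field.
by congr (_ +i* _); field.
Qed.

End Definitions.

(* Main.v *)
Require Import Defs.
From mathcomp Require Import all_boot all_order all_algebra.
From mathcomp Require Import all_classical all_reals all_analysis.
From mathcomp Require Import measurable_realfun.
From mathcomp Require Import complex ring lra.

Set Implicit Arguments.
Unset Strict Implicit.
Unset Printing Implicit Defensive.

Import Order.TTheory GRing.Theory Num.Theory.
Import numFieldNormedType.Exports.

Local Open Scope classical_set_scope.
Local Open Scope ring_scope.
Local Open Scope complex_scope.

(** Write [b_l (x) = (x - il) / (x + il)] and take two bubbles of very different
    sizes, [1/L] and [L]. Near the scale [L] the product [b_(1/L) b_L] is close to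
    [b_L], and near the scale [1/L] it is close to [- b_(1/L)], the sign being the
    value of the large bubble there. In the long neck between the two scales a
    slowly varying phase costs almost nothing, because [H^(1/2)] in dimension one
    barely controls oscillation across many scales. So one may turn one bubble by
    a half turn against the other and keep the energy arbitrarily close to 2,
    while no Blaschke product of degree 2 can be close to the result at both
    scales. The map is
    [u = b_(1/L) b_L exp (+- i pi phi)], with [phi] going from 1 to 0 in the neck.

    Energy. The profile [phi] is the average of [N] bumps at the scales [N^j];
    these are almost orthogonal in [H^(1/2)], so the energy of [phi] is [O(1/N)]
    ([energy_plateau]). The energy of the Blaschke product is at most 2
    ([energy_bphase]). For unimodular maps the squared chord between two values
    depends on the difference of the phases only, and the interaction of two
    phases changes sign with [phi], up to a term of the favourable sign. One of
    the two signs therefore gives energy at most [2 + O(1/N)]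
    ([phase_quot_sum], [exists_sign_energy]).

    Distance. Once [L] is large, [u] looks like [X |-> (X - i) / (X + i)] at both
    scales ([uphase_approx]). If a Blaschke product [psi] were close to [u], then
    [u - psi] would be nearly constant on a sample of three points of each scale,
    by averaging the double integral, and the constant would be nearly zero since
    both maps are unimodular ([sample_scale]). Now [psi = P / conj P] with [P]
    quadratic, so [Im (P (X + i))] would be small on each sample. These are six
    real linear equations in the six real coefficients of [P], and they are
    uniformly invertible when the ratio of the scales is small
    ([two_scale_rigidity]). Hence the distance stays above an absolute constant
    ([distance_lower_bound]), while the excess of energy tends to zero with [N].

    Degree. On the circle [u] is [exp (iF)] with [F t = 2 t + periodic], smooth.
    Then [k c_k] is the [k]-th Fourier coefficient of [F' exp (iF)], and Parseval
    identifies the sum of [k |c_k|^2] with the mean of [F'], which is 2. The form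
    of Parseval that is needed comes from Bessel's inequality and from a
    telescoping formula for the partial sums of a Fourier series at a point where
    the difference quotient is bounded ([bessel], [fourier_partial_sum],
    [weighted_modes_cvg]). *)

(** * Integrals over the line *)

Section LineIntegrals.
Context {R : realType}.
Local Notation mu := (@lebesgue_measure R).

Lemma continuous_kernel (a : R) : 0 < a ->
  continuous (fun x : R => a / (x ^+ 2 + a ^+ 2)).
Proof.
move=> a0 x; apply: cvgM; first exact: cvg_cst.
apply: cvgV; first by rewrite gt_eqF// ltr_wpDl ?sqr_ge0// exprn_gt0.
by apply: cvgD; [exact: exprn_continuous|exact: cvg_cst].
Qed.

Lemma integral_kernel (a : R) : 0 < a ->
  (\int[mu]_x (a / (x ^+ 2 + a ^+ 2))%:E = pi%:E)%E.
Proof.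
move=> a0.
have k0 (x : R) : 0 <= a / (x ^+ 2 + a ^+ 2).
  by apply: divr_ge0; [exact: ltW|rewrite addr_ge0 ?sqr_ge0].
rewrite ge0_symfun_integralT//; last 2 first.
- exact: continuous_kernel.
- by move=> x /=; rewrite sqrrN.
rewrite -set_itvcy.
rewrite (@ge0_continuous_FTC2y _ _ (fun x => atan (a^-1 * x)) 0 (pi / 2))//.
- by rewrite mulr0 atan0 sube0 -EFinM mulrC divfK.
- exact/continuous_subspaceT/continuous_kernel.
- apply: (cvg_comp _ _ _ (@cvgy_atan R)).
  by apply: gt0_cvgMry; [rewrite invr_gt0|exact: cvg_id].
- apply: cvg_at_right_filter; apply: continuous_comp; last exact: continuous_atan.
  by apply: cvgMl_tmp; exact: cvg_id.
- move=> x _; rewrite derive1E derive_val.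
  rewrite /GRing.scale /= mulr1 exprMn exprVn.
  have := sqr_ge0 x; move=> x0.
  by field; rewrite !gt_eqF// ltr_wpDl// exprn_gt0.
Qed.

Lemma ge0_integral_opp (f : R -> R) : (forall x, 0 <= f x) -> continuous f ->
  (\int[mu]_x (f (- x))%:E = \int[mu]_x (f x)%:E)%E.
Proof.
have split_ (g : R -> R) : (forall x, 0 <= g x) -> continuous g ->
  (\int[mu]_x (g x)%:E = \int[mu]_(x in `]-oo, 0%R]) (g x)%:E
     + \int[mu]_(x in `[0%R, +oo[) (g x)%:E)%E.
  move=> g0 cg.
  have mg : measurable_fun [set: R] g by exact: continuous_measurable_fun.
  rewrite -(@integral_itv_obnd_cbnd _ _ _ (EFin \o g)); last first.
    exact/measurable_EFinP/measurable_funTS.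
  rewrite -ge0_integral_setU//=.
  - by congr integral; rewrite -setCitvl setUv.
  - by apply/measurable_EFinP; rewrite -setCitvl setUv.
  - by move=> x _; rewrite lee_fin.
  - by rewrite -setCitvl; exact/disj_setPCl.
have half (g : R -> R) : (forall x, 0 <= g x) -> continuous g ->
  (\int[mu]_(x in `]-oo, 0%R]) (g x)%:E = \int[mu]_(x in `[0%R, +oo[) (g (- x))%:E)%E.
  move=> g0 cg; rewrite -{1}oppr0 ge0_integration_by_substitutionNy//.
  exact: continuous_subspaceT.
move=> f0 cf.
have cN : continuous (fun x => f (- x)).
  by move=> x; apply: continuous_comp; [exact: opp_continuous|exact: cf].
rewrite (split_ _ _ cf)// (split_ _ _ cN)// (half _ _ cf)// (half _ _ cN)//.
by rewrite addeC; congr (_ + _)%E; apply: eq_integral => x _; rewrite opprK.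
Qed.

Lemma integral_tensor (p q : R -> R) : (forall x, 0 <= p x) ->
    (forall x, 0 <= q x) -> continuous p -> continuous q ->
  (\int[(mu \x mu)%E]_z (p z.1 * q z.2)%:E =
   \int[mu]_x (p x)%:E * \int[mu]_x (q x)%:E)%E.
Proof.
move=> p0 q0 cp cq.
have mp : measurable_fun [set: R] p by exact: continuous_measurable_fun.
have mq : measurable_fun [set: R] q by exact: continuous_measurable_fun.
rewrite fubini_tonelli1/=; last 2 first.
- apply/measurable_EFinP; apply: measurable_funM.
    exact: (measurableT_comp mp).
  exact: (measurableT_comp mq).
- by move=> z; rewrite lee_fin mulr_ge0.
rewrite /fubini_F /=.
transitivity (\int[mu]_x ((p x)%:E * \int[mu]_y (q y)%:E))%E.
  apply: eq_integral => x _; under eq_integral do rewrite EFinM.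
  rewrite ge0_integralZl//.
  - exact/measurable_EFinP.
  - by move=> *; rewrite lee_fin.
  - by rewrite lee_fin.
apply: ge0_integralZr => //.
- exact/measurable_EFinP.
- by move=> *; rewrite lee_fin.
- by apply: integral_ge0 => *; rewrite lee_fin.
Qed.

End LineIntegrals.

(** * Chords and the half-angle substitution *)

Section Trigo.
Context {R : realType}.
Implicit Types s t x y : R.

Lemma cos_2atan s : cos (2 * atan s) = (1 - s ^+ 2) / (1 + s ^+ 2).
Proof.
have d0 : 1 + s ^+ 2 != 0 by rewrite gt_eqF// ltr_pwDl// sqr_ge0.
rewrite mulrC mulr_natr cos_mulr2n cos_atan exprVn sqr_sqrtr ?addr_ge0 ?sqr_ge0//.
by rewrite mulr2n; field.
Qed.

Lemma sin_2atan s : sin (2 * atan s) = 2 * s / (1 + s ^+ 2).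
Proof.
have d0 : 1 + s ^+ 2 != 0 by rewrite gt_eqF// ltr_pwDl// sqr_ge0.
have s0 : 0 < Num.sqrt (1 + s ^+ 2) by rewrite sqrtr_gt0 ltr_pwDl// sqr_ge0.
have c0 : cos (atan s) != 0 by rewrite cos_atan invr_eq0 gt_eqF.
have sE : sin (atan s) = s * cos (atan s) by rewrite -{2}[s]atanK /tan divfK.
rewrite mulrC mulr_natr sin_mulr2n sE mulrCA -expr2 cos_atan exprVn.
by rewrite sqr_sqrtr ?addr_ge0 ?sqr_ge0// mulr2n; field.
Qed.

Lemma sin_lipschitz x y : `|sin x - sin y| <= `|x - y|.
Proof.
wlog xy : x y / y <= x.
  move=> H; have [|/ltW xy] := leP y x; first exact: H.
  by rewrite distrC (distrC x); exact: H.
have dsin z : z \in `]y, x[ -> is_derive z 1 sin (cos z).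
  by move=> _; exact: is_derive_sin.
have [|c _ ->] := MVT_segment xy dsin.
  exact/continuous_subspaceT/continuous_sin.
by rewrite normrM ler_piMl// cos_max.
Qed.

Lemma cos_lipschitz x y : `|cos x - cos y| <= `|x - y|.
Proof.
have := sin_lipschitz (x + pi / 2) (y + pi / 2).
by rewrite !sinDpihalf opprD addrACA subrr addr0.
Qed.

(** The left-hand side is the squared chord of an arc of length [t]. *)
Lemma one_sub_cos_le t : 2 - 2 * cos t <= t ^+ 2.
Proof.
have := sin_lipschitz (t / 2) 0; rewrite sin0 !subr0 => H.
have -> : cos t = 1 - 2 * sin (t / 2) ^+ 2.
  rewrite [t in LHS](_ : _ = (t / 2) *+ 2); last by rewrite mulr2n; field.
  by rewrite cos_mulr2n cos2sin2 mulr2n; ring.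
have : sin (t / 2) ^+ 2 <= (t / 2) ^+ 2.
  by rewrite -(real_normK (num_real (sin _))) -(real_normK (num_real (t / 2))) lerXn2r ?nnegrE.
by rewrite expr_div_n; lra.
Qed.

End Trigo.

(** * The energy of a unimodular map in terms of its phase *)

Section Energy.
Context {R : realType}.
Local Notation mu := (@lebesgue_measure R).
Local Notation mu2 := ((mu \x mu)%E).

(** The inverse is continuous off the origin, and a point does not matter. *)
Lemma measurable_inv : measurable_fun [set: R] (@GRing.inv R).
Proof.
have -> : [set: R] = [set 0] `|` ~` [set 0] by rewrite setUv.
apply/measurable_funU => //; first exact: measurableC.
split; first exact: measurable_fun_set1.
apply: open_continuous_measurable_fun.
  by apply: closed_openC; exact: closed_eq.
by move=> x; rewrite inE /= => /eqP x0; exact: inv_continuous.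
Qed.

(** The integrand of the seminorm of [cis \o f], see [Hhalf_cis]. Working with
    phases turns products of unimodular maps into sums. *)
Definition phase_quot (f : R -> R) (z : R * R) : R :=
  (2 - 2 * cos (f z.1 - f z.2)) / (z.1 - z.2) ^+ 2.

Lemma phase_quot_ge0 f z : 0 <= phase_quot f z.
Proof.
by rewrite divr_ge0 ?sqr_ge0// subr_ge0 -[leRHS]mulr1 ler_pM2l// cos_le1.
Qed.

Lemma measurable_phase_quot f : continuous f ->
  measurable_fun [set: R * R] (phase_quot f).
Proof.
move=> cf; have mf : measurable_fun [set: R] f by exact: continuous_measurable_fun.
apply: measurable_funM.
  apply: measurable_funB; first exact: measurable_cst.
  apply: measurable_funM; first exact: measurable_cst.
  apply: (measurableT_comp (f := cos)).
    exact: continuous_measurable_fun (@continuous_cos R).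
  by apply: measurable_funB; exact: measurableT_comp.
apply: (measurableT_comp measurable_inv).
by apply: measurable_funX; apply: measurable_funB.
Qed.

Lemma cabs_sqr (z : R[i]) : cabs z ^+ 2 = complex.Re z ^+ 2 + complex.Im z ^+ 2.
Proof. by case: z => a b; rewrite /cabs /= sqr_sqrtr// addr_ge0 ?sqr_ge0. Qed.

Lemma cabs_cisB (s t : R) : cabs (cis s - cis t) ^+ 2 = 2 - 2 * cos (s - t).
Proof.
rewrite cabs_sqr /= cosB; have := cos2Dsin2 s; have := cos2Dsin2 t.
move=> h1 h2; have -> : 2 = cos s ^+ 2 + sin s ^+ 2 + (cos t ^+ 2 + sin t ^+ 2) :> R.
  by rewrite h1 h2.
by rewrite h1 h2 -{1}h1 -{1}h2; ring.
Qed.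

Lemma Hhalf_cis f :
  Hhalf_sqnorm (fun x => cis (f x)) =
  (((4 * pi ^+ 2)^-1)%:E * \int[mu2]_z (phase_quot f z)%:E)%E.
Proof.
rewrite /Hhalf_sqnorm; congr (_ * _)%E; apply: eq_integral => z _.
by rewrite cabs_cisB real_normK ?num_real.
Qed.

Lemma ge0_le_integral2 (F G : R * R -> R) :
    measurable_fun [set: R * R] F -> measurable_fun [set: R * R] G ->
    (forall z, 0 <= F z <= G z) ->
  (\int[mu2]_z (F z)%:E <= \int[mu2]_z (G z)%:E)%E.
Proof.
move=> mF mG FG; apply: ge0_le_integral => //.
- by move=> z _; rewrite lee_fin; case/andP: (FG z).
- exact/measurable_EFinP.
- exact/measurable_EFinP.
- by move=> z _; rewrite lee_fin; case/andP: (FG z).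
Qed.

Lemma ge0_integralD2 (F G : R * R -> R) :
    measurable_fun [set: R * R] F -> measurable_fun [set: R * R] G ->
    (forall z, 0 <= F z) -> (forall z, 0 <= G z) ->
  (\int[mu2]_z (F z + G z)%:E = \int[mu2]_z (F z)%:E + \int[mu2]_z (G z)%:E)%E.
Proof.
move=> mF mG F0 G0; under eq_integral do rewrite EFinD.
apply: ge0_integralD => //; (try by move=> z _; rewrite lee_fin);
  exact/measurable_EFinP.
Qed.

Lemma ge0_integralZ2 (F : R * R -> R) c :
    measurable_fun [set: R * R] F -> (forall z, 0 <= F z) -> 0 <= c ->
  (\int[mu2]_z (c * F z)%:E = c%:E * \int[mu2]_z (F z)%:E)%E.
Proof.
move=> mF F0 c0; under eq_integral do rewrite EFinM.
apply: ge0_integralZl => //; first exact/measurable_EFinP.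
by move=> z _; rewrite lee_fin.
Qed.

(** The cross terms of the two squared chords have opposite signs, so at least
    one of the two signs does not gain energy from the interaction. *)
Lemma phase_quot_sum (f g : R -> R) : continuous f -> continuous g ->
  (\int[mu2]_z (phase_quot (fun x => f x + g x)%R z)%:E +
   \int[mu2]_z (phase_quot (fun x => f x - g x)%R z)%:E <=
   2%:E * (\int[mu2]_z (phase_quot f z)%:E + \int[mu2]_z (phase_quot g z)%:E))%E.
Proof.
move=> cf cg.
have cD : continuous (fun x => f x + g x) by move=> x; apply: cvgD; [exact: cf|exact: cg].
have cB : continuous (fun x => f x - g x) by move=> x; apply: cvgB; [exact: cf|exact: cg].
have [mD mB] := (measurable_phase_quot cD, measurable_phase_quot cB).
have [mf mg] := (measurable_phase_quot cf, measurable_phase_quot cg).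
have pq0 := phase_quot_ge0.
rewrite -!ge0_integralD2// -ge0_integralZ2//; last 2 first.
- exact: measurable_funD.
- by move=> z; rewrite addr_ge0.
apply: ge0_le_integral2.
- exact: measurable_funD.
- by apply: measurable_funM; [exact: measurable_cst|exact: measurable_funD].
move=> [x y]; rewrite addr_ge0//= /phase_quot /= -!mulrDl mulrA.
apply: ler_wpM2r; first by rewrite invr_ge0 sqr_ge0.
set b := f x - f y; set c := g x - g y.
have -> : f x + g x - (f y + g y) = b + c by rewrite /b /c; ring.
have -> : f x - g x - (f y - g y) = b - c by rewrite /b /c; ring.
rewrite cosB cosD.
have := mulr_ge0 (_ : 0 <= 1 - cos b) (_ : 0 <= 1 - cos c).
rewrite !subr_ge0 !cos_le1 => /(_ isT isT); nra.
Qed.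

Lemma phase_quot_le_sqr (f : R -> R) z :
  phase_quot f z <= ((f z.1 - f z.2) / (z.1 - z.2)) ^+ 2.
Proof.
rewrite expr_div_n ler_wpM2r ?invr_ge0 ?sqr_ge0//; exact: one_sub_cos_le.
Qed.

End Energy.

(** * Finite combinations of product kernels *)

Section Mass.
Context {R : realType}.
Local Notation mu := (@lebesgue_measure R).
Local Notation mu2 := ((mu \x mu)%E).

(** Every kernel below is a combination of products [p x * q y] with [p], [q] of
    known integral. Bundling the value of the integral with the side conditions
    lets such combinations be evaluated by composition. *)
Definition mass (p : R -> R) (m : R) : Prop :=
  [/\ forall x, 0 <= p x, continuous p & (\int[mu]_x (p x)%:E = m%:E)%E].

Definition mass2 (F : R * R -> R) (m : R) : Prop :=
  [/\ forall z, 0 <= F z, measurable_fun [set: R * R] F &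
      (\int[mu2]_z (F z)%:E = m%:E)%E].

Lemma mass_kernel a : 0 < a -> mass (fun x : R => a / (x ^+ 2 + a ^+ 2)) pi.
Proof.
move=> a0; split; [|exact: continuous_kernel|exact: integral_kernel].
by move=> x; apply: divr_ge0; [exact: ltW|rewrite addr_ge0 ?sqr_ge0].
Qed.

Lemma mass_tensor p q m n : mass p m -> mass q n ->
  mass2 (fun z => p z.1 * q z.2) (m * n).
Proof.
move=> [p0 cp ip] [q0 cq iq]; split.
- by move=> z; rewrite mulr_ge0.
- by apply: measurable_funM; apply: measurableT_comp => //;
    exact: continuous_measurable_fun.
- by rewrite integral_tensor// ip iq EFinM.
Qed.

Lemma mass2D F G m n : mass2 F m -> mass2 G n ->
  mass2 (fun z => F z + G z) (m + n).
Proof.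
move=> [F0 mF iF] [G0 mG iG]; split.
- by move=> z; rewrite addr_ge0.
- exact: measurable_funD.
- by rewrite ge0_integralD2// iF iG.
Qed.

Lemma mass2Z F c m : 0 <= c -> mass2 F m -> mass2 (fun z => c * F z) (c * m).
Proof.
move=> c0 [F0 mF iF]; split.
- by move=> z; rewrite mulr_ge0.
- by apply: measurable_funM => //; exact: measurable_cst.
- by rewrite ge0_integralZ2// iF EFinM.
Qed.

Lemma mass2_sum (I : Type) (s : seq I) (F : I -> R * R -> R) (m : I -> R) :
    (forall i, mass2 (F i) (m i)) ->
  mass2 (fun z => \sum_(i <- s) F i z) (\sum_(i <- s) m i).
Proof.
move=> H; elim: s => [|i s IH].
  under [X in mass2 X _]eq_fun do rewrite big_nil.
  rewrite big_nil; split => //.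
  by rewrite integral0.
under [X in mass2 X _]eq_fun do rewrite big_cons.
by rewrite big_cons; exact: mass2D.
Qed.

Lemma le_mass2 (F Y : R * R -> R) n : (forall z, 0 <= F z) -> measurable_fun [set: R * R] F ->
    mass2 Y n -> (forall z, F z <= Y z) ->
  (\int[mu2]_z (F z)%:E <= n%:E)%E.
Proof.
move=> F0 mF [Y0 mY <-] FY; apply: ge0_le_integral2 => // z.
by rewrite F0 FY.
Qed.

(** Signed kernels are moved to the side where they are positive, so that only
    integrals of nonnegative functions occur: in the applications [X] and [Y]
    share the contribution of these kernels, and it cancels in [n - m]. *)
Lemma balanced_mass2 (F X Y : R * R -> R) m n :
    (forall z, 0 <= F z) -> measurable_fun [set: R * R] F ->
    mass2 X m -> mass2 Y n -> (forall z, F z + X z <= Y z) ->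
  (\int[mu2]_z (F z)%:E <= (n - m)%:E)%E.
Proof.
move=> F0 mF [X0 mX iX] [Y0 mY iY] FXY.
rewrite EFinB leeBrDr// -iX -ge0_integralD2// -iY.
apply: ge0_le_integral2 => //; first exact: measurable_funD.
by move=> z; rewrite addr_ge0 ?FXY.
Qed.

End Mass.

(** * The energy of a product of two Blaschke factors *)

Section Blaschke.
Context {R : realType}.
Local Notation mu := (@lebesgue_measure R).
Local Notation mu2 := ((mu \x mu)%E).

(** Since [(x - il) / (x + il) = - exp (2 i atan (x / l))], this is the phase of
    the product of two Blaschke factors. *)
Definition bphase (a b x : R) : R := 2 * atan (x / a) + 2 * atan (x / b).

Lemma continuous_bphase a b : continuous (bphase a b).
Proof.
by move=> x; apply: cvgD; apply: cvgMl_tmp;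
  (apply: continuous_cvg; [exact: continuous_atan|apply: cvgMr_tmp; exact: cvg_id]).
Qed.

Lemma cos_bphase a b x : 0 < a -> 0 < b -> cos (bphase a b x) =
  ((a ^+ 2 - x ^+ 2) * (b ^+ 2 - x ^+ 2) - 4 * a * b * x ^+ 2) /
  ((x ^+ 2 + a ^+ 2) * (x ^+ 2 + b ^+ 2)).
Proof.
move=> a0 b0; rewrite /bphase cosD !cos_2atan !sin_2atan.
have H (c : R) : 0 < c -> x ^+ 2 + c ^+ 2 != 0.
  by move=> c0; rewrite gt_eqF// ltr_wpDl ?sqr_ge0// exprn_gt0.
have [ha hb] := (H _ a0, H _ b0).
by field; rewrite hb ha !gt_eqF.
Qed.

Lemma sin_bphase a b x : 0 < a -> 0 < b -> sin (bphase a b x) =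
  (2 * a * x * (b ^+ 2 - x ^+ 2) + 2 * b * x * (a ^+ 2 - x ^+ 2)) /
  ((x ^+ 2 + a ^+ 2) * (x ^+ 2 + b ^+ 2)).
Proof.
move=> a0 b0; rewrite /bphase sinD !cos_2atan !sin_2atan.
have H (c : R) : 0 < c -> x ^+ 2 + c ^+ 2 != 0.
  by move=> c0; rewrite gt_eqF// ltr_wpDl ?sqr_ge0// exprn_gt0.
have [ha hb] := (H _ a0, H _ b0).
by field; rewrite hb ha !gt_eqF.
Qed.

Local Notation ker a x := (a / (x ^+ 2 + a ^+ 2)).
(** [x * odd_ker a b x] is, up to sign, the imaginary part of
    [((x + ia) (x + ib))^-1]; its real part is [(ker b x - ker a x) / (b - a)]. *)
Definition odd_ker (a b x : R) := (a + b) / ((x ^+ 2 + a ^+ 2) * (x ^+ 2 + b ^+ 2)).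

Lemma phase_quot_bphase a b x y : 0 < a -> a < b -> x != y ->
  phase_quot (bphase a b) (x, y) =
  4 * (ker a x * ker a y) + 4 * (ker b x * ker b y) +
  8 * a * b / (b - a) ^+ 2 * ((ker b x - ker a x) * (ker b y - ker a y)) +
  8 * a * b * ((x * odd_ker a b x) * (y * odd_ker a b y)).
Proof.
move=> a0 ab xy; have b0 := lt_trans a0 ab.
rewrite /phase_quot/= cosB !cos_bphase// !sin_bphase// /odd_ker.
have H (z c : R) : 0 < c -> z ^+ 2 + c ^+ 2 != 0.
  by move=> c0; rewrite gt_eqF// ltr_wpDl ?sqr_ge0// exprn_gt0.
have [hxa hxb] := (H x _ a0, H x _ b0).
have [hya hyb] := (H y _ a0, H y _ b0).
have xy0 : x - y != 0 by rewrite subr_eq0.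
have ba0 : b - a != 0 by rewrite subr_eq0 gt_eqF.
by field; rewrite hxa hxb hya hyb xy0 ba0.
Qed.

(** An odd integrable function has positive and negative parts of equal mass.
    Here [`|x| + x] is at most [(x^2 + b^2) / b], which leaves an integrable
    kernel. *)
Lemma mass_odd_part (a b : R) : 0 < a -> 0 < b -> exists m,
  mass (fun x => (`|x| + x) / 2 * odd_ker a b x) m /\
  mass (fun x => (`|x| - x) / 2 * odd_ker a b x) m.
Proof.
move=> a0 b0.
have H (z c : R) : 0 < c -> 0 < z ^+ 2 + c ^+ 2.
  by move=> c0; rewrite ltr_wpDl ?sqr_ge0// exprn_gt0.
have o0 x : 0 <= odd_ker a b x.
  by apply: divr_ge0; [rewrite addr_ge0// ltW|rewrite ltW// mulr_gt0// H].
have co : continuous (odd_ker a b).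
  move=> x; apply: cvgM; first exact: cvg_cst.
  apply: cvgV; first by rewrite gt_eqF// mulr_gt0// H.
  apply: cvgM; apply: cvgD; try exact: exprn_continuous; exact: cvg_cst.
pose p x := (`|x| + x) / 2 * odd_ker a b x.
pose q x := (`|x| - x) / 2 * odd_ker a b x.
have p0 x : 0 <= p x.
  by rewrite mulr_ge0// divr_ge0// -lerBlDr sub0r -normrN ler_norm.
have q0 x : 0 <= q x by rewrite mulr_ge0// divr_ge0// subr_ge0 ler_norm.
have cp : continuous p.
  move=> x; apply: cvgM; last exact: co.
  by apply: cvgMr_tmp; apply: cvgD; [exact: norm_continuous|exact: cvg_id].
have cq : continuous q.
  move=> x; apply: cvgM; last exact: co.
  by apply: cvgMr_tmp; apply: cvgB; [exact: norm_continuous|exact: cvg_id].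
have qE : (\int[mu]_x (q x)%:E = \int[mu]_x (p x)%:E)%E.
  rewrite -(ge0_integral_opp p0 cp); apply: eq_integral => x _.
  by rewrite /p /q normrN /odd_ker sqrrN.
have pfin : (\int[mu]_x (p x)%:E)%E \is a fin_num.
  rewrite ge0_fin_numE; last by apply: integral_ge0 => x _; rewrite lee_fin.
  apply: (@le_lt_trans _ _ (((a + b) / (2 * a * b))%:E * pi%:E)%E); last exact: ltry.
  rewrite -(integral_kernel a0) -ge0_integralZl//; last 3 first.
  - apply/measurable_EFinP; apply: continuous_measurable_fun.
    exact: continuous_kernel.
  - by move=> x _; rewrite lee_fin ltW// divr_gt0// H.
  - by rewrite lee_fin divr_ge0// ?mulr_ge0// ?addr_ge0// ltW.
  apply: ge0_le_integral => //.
  - by move=> x _; rewrite lee_fin.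
  - by apply/measurable_EFinP; exact: continuous_measurable_fun.
  - apply: measurable_funeM; apply/measurable_EFinP.
    by apply: continuous_measurable_fun; exact: continuous_kernel.
  move=> x _; rewrite -EFinM lee_fin /p /odd_ker.
  have xb : `|x| + x <= (x ^+ 2 + b ^+ 2) / b.
    rewrite ler_pdivlMr//.
    have := ler_norm x; have := real_normK (num_real x) => <-.
    by have := sqr_ge0 (`|x| - b); nra.
  have [ha hb] := (H x _ a0, H x _ b0).
  have -> : (a + b) / (2 * a * b) * (a / (x ^+ 2 + a ^+ 2)) =
    ((x ^+ 2 + b ^+ 2) / b) / 2 * ((a + b) / ((x ^+ 2 + a ^+ 2) * (x ^+ 2 + b ^+ 2))).
    by field; rewrite !gt_eqF.
  by apply: ler_wpM2r; [exact: o0|rewrite ler_pM2r].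
exists (fine (\int[mu]_x (p x)%:E)%E); split; split => //.
- by rewrite fineK.
- by rewrite fineK.
Qed.

(** The two factors contribute [4 * pi ^ 2] each; the interaction integrates
    to [|\int g| ^ 2] for [g x = ((x + ia) (x + ib))^-1], analytic in the upper
    half-plane, hence to zero. In real terms: both [ker b - ker a] and
    [x * odd_ker a b x] have zero mean. *)
Lemma energy_bphase (a b : R) : 0 < a -> a < b ->
  (\int[mu2]_z (phase_quot (bphase a b) z)%:E <= (8 * pi ^+ 2)%:E)%E.
Proof.
move=> a0 ab; have b0 := lt_trans a0 ab.
have [m [Mp Mq]] := mass_odd_part a0 b0.
have [Ma Mb] := (mass_kernel a0, mass_kernel b0).
have c0 : 0 <= 8 * a * b by rewrite !mulr_ge0// ltW.
have c1 : 0 <= 8 * a * b / (b - a) ^+ 2 by rewrite divr_ge0// sqr_ge0.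
have four : 0 <= 4 :> R by [].
pose X := mass2D (mass2Z c1 (mass2D (mass_tensor Ma Mb) (mass_tensor Mb Ma)))
  (mass2Z c0 (mass2D (mass_tensor Mp Mq) (mass_tensor Mq Mp))).
pose Y := mass2D (mass2D (mass2Z four (mass_tensor Ma Ma))
                         (mass2Z four (mass_tensor Mb Mb)))
  (mass2D (mass2Z c1 (mass2D (mass_tensor Ma Ma) (mass_tensor Mb Mb)))
  (mass2Z c0 (mass2D (mass_tensor Mp Mp) (mass_tensor Mq Mq)))).
apply: le_trans (balanced_mass2 (phase_quot_ge0 (bphase a b))
  (measurable_phase_quot (@continuous_bphase a b)) X Y _) _; last first.
  by rewrite lee_fin le_eqVlt; apply/orP; left; apply/eqP; ring.
move=> [x y]; have [<-/=|xy] := eqVneq x y.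
  (* On the diagonal the quotient is 0 and the bound is a sum of squares. *)
  rewrite /phase_quot/= !subrr cos0 mulr1 subrr mul0r add0r.
  have k0 c : 0 < c -> 0 <= ker c x.
    by move=> ?; rewrite divr_ge0 ?addr_ge0 ?sqr_ge0// ltW.
  rewrite -subr_ge0; set ka := ker a x; set kb := ker b x.
  set s := 8 * a * b; set t := s / _; set o := odd_ker a b x.
  have -> : 4 * (ka * ka) + 4 * (kb * kb) + (t * (ka * ka + kb * kb) +
   s * ((`|x| + x) / 2 * o * ((`|x| + x) / 2 * o) + (`|x| - x) / 2 * o * ((`|x| - x) / 2 * o))) -
   (t * (ka * kb + kb * ka) +
    s * ((`|x| + x) / 2 * o * ((`|x| - x) / 2 * o) + (`|x| - x) / 2 * o * ((`|x| + x) / 2 * o)))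
   = 4 * ka ^+ 2 + 4 * kb ^+ 2 + t * (ka - kb) ^+ 2 + s * (x * o) ^+ 2.
    by field.
  by rewrite !addr_ge0// mulr_ge0// sqr_ge0.
rewrite phase_quot_bphase//= le_eqVlt; apply/orP; left; apply/eqP.
set ka := ker a x; set kb := ker b x; set la := ker a y; set lb := ker b y.
set s := 8 * a * b; set t := s / _.
set o := odd_ker a b x; set o' := odd_ker a b y.
by field.
Qed.

End Blaschke.

(** * A profile of small energy *)

Section Plateau.
Context {R : realType}.
Local Notation mu := (@lebesgue_measure R).
Local Notation mu2 := ((mu \x mu)%E).
Local Notation ker a x := (a / (x ^+ 2 + a ^+ 2)).

(** Each summand passes from 1 to 0 around its own scale [N^j]. *)
Definition plateau (N : nat) (x : R) : R :=
  N%:R^-1 * \sum_(j < N) (N%:R ^+ j) ^+ 2 / (x ^+ 2 + (N%:R ^+ j) ^+ 2).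

Lemma sqrD_gt0 (x a : R) : 0 < a -> 0 < x ^+ 2 + a ^+ 2.
Proof. by move=> a0; rewrite ltr_wpDl ?sqr_ge0// exprn_gt0. Qed.

Lemma continuous_plateau N : continuous (plateau N.+1).
Proof.
move=> x; apply: cvgMl_tmp.
apply: cvg_big => [|j _]; first exact: add_continuous.
apply: cvgM; first exact: cvg_cst.
apply: cvgV; first by rewrite gt_eqF// sqrD_gt0// exprn_gt0.
by apply: cvgD; [exact: exprn_continuous|exact: cvg_cst].
Qed.

(** [(x - y) (x + y) * bump a x y] is the increment of [a^2 / (x^2 + a^2)],
    up to sign. *)
Let bump (a x y : R) := a ^+ 2 / ((x ^+ 2 + a ^+ 2) * (y ^+ 2 + a ^+ 2)).

(** The scalar product of the bumps at scales [a <= b] is of order [a / b]. *)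
Lemma bump_pair_le (a b x y : R) : 0 < a -> a <= b ->
  (x + y) ^+ 2 * (bump a x y * bump b x y) <=
  2 * (a / b) * (ker a x * ker b y + ker b x * ker a y).
Proof.
move=> a0 ab; have b0 := lt_le_trans a0 ab.
have [xa xb] := (sqrD_gt0 x a0, sqrD_gt0 x b0).
have [ya yb] := (sqrD_gt0 y a0, sqrD_gt0 y b0).
have key (u v : R) : 0 < u ^+ 2 + a ^+ 2 -> 0 < u ^+ 2 + b ^+ 2 ->
    0 < v ^+ 2 + a ^+ 2 -> 0 < v ^+ 2 + b ^+ 2 ->
    u ^+ 2 * (bump a u v * bump b u v) <= a / b * (ker b u * ker a v).
  move=> ua ub va vb.
  have -> : u ^+ 2 * (bump a u v * bump b u v) =
    (u ^+ 2 / (u ^+ 2 + a ^+ 2) * (b ^+ 2 / (v ^+ 2 + b ^+ 2))) *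
      (a / b * (ker b u * ker a v)).
    by rewrite /bump; field; rewrite !gt_eqF.
  apply: ler_piMl.
    by rewrite !mulr_ge0 ?invr_ge0// ltW.
  apply: mulr_ile1.
  - by rewrite divr_ge0 ?sqr_ge0// ltW.
  - by rewrite divr_ge0 ?sqr_ge0// ltW.
  - by rewrite ler_pdivrMr// mul1r lerDl sqr_ge0.
  - by rewrite ler_pdivrMr// mul1r lerDr sqr_ge0.
have b_sym u v c : bump c u v = bump c v u by rewrite /bump mulrC [X in _ = _ / X]mulrC mulrC.
have kx := key x y xa xb ya yb.
have ky := key y x ya yb xa xb.
have bb : 0 <= bump a x y * bump b x y.
  by rewrite mulr_ge0// divr_ge0 ?sqr_ge0// ltW// mulr_gt0.
apply: (@le_trans _ _ (2 * (x ^+ 2 + y ^+ 2) * (bump a x y * bump b x y))).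
  apply: ler_wpM2r => //; rewrite -subr_ge0.
  by have -> : 2 * (x ^+ 2 + y ^+ 2) - (x + y) ^+ 2 = (x - y) ^+ 2; [ring|rewrite sqr_ge0].
rewrite -[leLHS]mulrA -(mulrA 2 (a / b)) ler_pM2l// mulrDl.
apply: le_trans (lerD kx (_ : _ <= a / b * (ker b y * ker a x))) _.
  by rewrite (b_sym x y a) (b_sym x y b).
by rewrite le_eqVlt; apply/orP; left; apply/eqP; field; rewrite !gt_eqF.
Qed.

(** Distinct scales differ at least by a factor [N]. *)
Let weight N (j k : 'I_N) : R := if j == k then 1 else N%:R^-1.

Lemma scale_pair_le N (j k : 'I_N.+1) x y :
  (x + y) ^+ 2 * (bump (N.+1%:R ^+ j) x y * bump (N.+1%:R ^+ k) x y) <=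
  2 * weight j k * (ker (N.+1%:R ^+ j) x * ker (N.+1%:R ^+ k) y +
                    ker (N.+1%:R ^+ k) x * ker (N.+1%:R ^+ j) y).
Proof.
have N1 : 1 <= N.+1%:R :> R by rewrite ler1n.
have L0 i : 0 < N.+1%:R ^+ i :> R by rewrite exprn_gt0.
wlog jk : j k / (j <= k)%N.
  move=> H; have [|/ltnW kj] := leqP j k; first exact: H.
  by rewrite [bump _ _ _ * _]mulrC /weight eq_sym [X in _ <= _ * X]addrC; exact: H.
have Ljk : N.+1%:R ^+ j <= N.+1%:R ^+ k :> R by rewrite ler_weXn2l.
apply: le_trans (bump_pair_le x y (L0 j) Ljk) _.
apply: ler_wpM2r.
  have p (i : nat) (u : R) : 0 <= ker (N.+1%:R ^+ i) u.
    by rewrite divr_ge0// ltW// sqrD_gt0.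
  by rewrite addr_ge0// mulr_ge0.
rewrite ler_pM2l// /weight; have [->|njk] := eqVneq; first by rewrite divff// gt_eqF.
have {}jk : (j < k)%N by rewrite ltn_neqAle jk andbT.
have -> : N.+1%:R ^+ k = N.+1%:R * (N.+1%:R ^+ (k - j.+1) * N.+1%:R ^+ j) :> R.
  by rewrite -exprD -exprS -addnS subnK.
rewrite ler_pdivrMr ?mulr_gt0// mulKf ?pnatr_eq0//.
by apply: ler_peMl; [exact: ltW|exact: exprn_ege1].
Qed.

Lemma sum_weight N : \sum_(j < N.+1) \sum_(k < N.+1) weight j k <= 2 * N.+1%:R.
Proof.
have row (j : 'I_N.+1) : \sum_(k < N.+1) weight j k <= 2.
  rewrite (bigD1 j)//= /weight eqxx.
  rewrite [leRHS](_ : 2 = 1 + 1)//; apply: lerD => //.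
  under eq_bigr => k kj do rewrite eq_sym (negPf kj).
  rewrite sumr_const -[_ *+ #|_|]mulr_natl.
  rewrite ler_pdivrMr// mul1r ler_nat.
  by apply: leq_trans (max_card _) _; rewrite card_ord.
apply: le_trans (ler_sum _ (fun j _ => row j)) _.
by rewrite sumr_const card_ord mulr_natr.
Qed.

Lemma plateau_quot N x y : x != y ->
  (plateau N.+1 x - plateau N.+1 y) / (x - y) =
  - (N.+1%:R^-1 * ((x + y) * \sum_(j < N.+1) bump (N.+1%:R ^+ j) x y)).
Proof.
move=> xy; have xy0 : x - y != 0 by rewrite subr_eq0.
rewrite /plateau -mulrBr -sumrB -mulrA -mulrN; congr (_ * _).
rewrite mulr_sumr mulr_suml -sumrN; apply: eq_bigr => j _.
have L0 : 0 < N.+1%:R ^+ j :> R by rewrite exprn_gt0.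
rewrite /bump; set a := N.+1%:R ^+ j.
by field; rewrite xy0 !gt_eqF// sqrD_gt0.
Qed.

(** The scales are so far apart that the bumps are almost orthogonal:
    averaging [N] of them divides the energy by [N]. *)
Lemma energy_plateau N :
  (\int[mu2]_z (phase_quot (fun x => pi * plateau N.+1 x)%R z)%:E <=
   (8 * pi ^+ 4 / N.+1%:R)%:E)%E.
Proof.
pose L (j : 'I_N.+1) : R := N.+1%:R ^+ j.
have L0 j : 0 < L j by rewrite exprn_gt0.
have w0 j k : 0 <= 2 * @weight N.+1 j k by rewrite mulr_ge0// /weight; case: ifP.
have M j k := mass2Z (w0 j k)
  (mass2D (mass_tensor (mass_kernel (L0 j)) (mass_kernel (L0 k)))
          (mass_tensor (mass_kernel (L0 k)) (mass_kernel (L0 j)))).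
have c0 : 0 <= pi ^+ 2 * N.+1%:R^-1 ^+ 2 :> R by rewrite mulr_ge0// sqr_ge0.
have Y := mass2Z c0 (mass2_sum (index_enum 'I_N.+1)
  (fun j => mass2_sum (index_enum 'I_N.+1) (M j))).
have cf : continuous (fun x : R => pi * plateau N.+1 x).
  by move=> x; apply: cvgMl_tmp; exact: continuous_plateau.
apply: le_trans (le_mass2 (phase_quot_ge0 _) (measurable_phase_quot cf) Y _) _.
  move=> [x y] /=.
  have [<-|xy] := eqVneq x y.
    rewrite /phase_quot/= !subrr cos0 mulr1 subrr mul0r.
    by case: Y => /(_ (x, x)).
  apply: le_trans (phase_quot_le_sqr _ _) _ => /=.
  rewrite -mulrBr -mulrA plateau_quot// exprMn sqrrN exprMn mulrA.
  apply: ler_wpM2l => //; rewrite exprMn expr2 (expr2 (\sum_(_ < _) _)) mulr_suml -expr2.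
  rewrite mulr_sumr; apply: ler_sum => j _.
  rewrite mulr_sumr mulr_sumr; apply: ler_sum => k _.
  exact: scale_pair_le.
rewrite lee_fin.
under eq_bigr do rewrite -mulr_suml -mulr_sumr.
rewrite -mulr_suml -mulr_sumr.
have pp : 0 < pi * pi :> R by rewrite mulr_gt0// pi_gt0.
have S := sum_weight N.
apply: (@le_trans _ _ (pi ^+ 2 * N.+1%:R^-1 ^+ 2 * (2 * (2 * N.+1%:R) * (pi * pi + pi * pi)))).
  apply: ler_wpM2l => //; apply: ler_wpM2r; first by rewrite addr_ge0// ltW.
  by rewrite ler_pM2l.
by rewrite le_eqVlt; apply/orP; left; apply/eqP; field; rewrite ?pnatr_eq0.
Qed.

End Plateau.

(** * The candidate map *)

Section Candidate.
Context {R : realType}.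
Local Notation mu := (@lebesgue_measure R).
Local Notation mu2 := ((mu \x mu)%E).

Definition uphase (L s : R) (N : nat) (x : R) : R :=
  bphase L^-1 L x + s * (pi * plateau N x).

Lemma continuous_uphase L s N : continuous (uphase L s N.+1).
Proof.
move=> x; apply: cvgD; first exact: continuous_bphase.
by apply: cvgMl_tmp; apply: cvgMl_tmp; exact: continuous_plateau.
Qed.

(** The energies for the two signs add up to at most twice [2 + O(1/N)]. *)
Lemma exists_sign_energy N (L : R) : 1 < L -> exists s : R, (s = 1 \/ s = -1) /\
  (Hhalf_sqnorm (fun x => cis (uphase L s N.+1 x)) <= (2 + 2 * pi ^+ 2 / N.+1%:R)%:E)%E.
Proof.
move=> L1; have L0 : 0 < L by exact: lt_trans L1.
have aL : L^-1 < L by apply: (lt_trans _ L1); rewrite invf_lt1.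
have i0 : 0 < L^-1 by rewrite invr_gt0.
have cf := @continuous_bphase R L^-1 L.
have cg : continuous (fun x : R => pi * plateau N.+1 x).
  by move=> x; apply: cvgMl_tmp; exact: continuous_plateau.
have := phase_quot_sum cf cg.
set A := (\int[_]_z _)%E; set B := (\int[_]_z _)%E => AB.
pose K : R := 8 * pi ^+ 2 + 8 * pi ^+ 4 / N.+1%:R.
have ABK : (A + B <= 2%:E * K%:E)%E.
  apply: (le_trans AB); apply: lee_wpmul2l; first by rewrite lee_fin.
  by rewrite EFinD; apply: leeD; [exact: energy_bphase|exact: energy_plateau].
have pi0 : pi != 0 :> R by rewrite gt_eqF// pi_gt0.
have fin C : (C <= K%:E)%E ->
    (((4 * pi ^+ 2)^-1)%:E * C <= (2 + 2 * pi ^+ 2 / N.+1%:R)%:E)%E.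
  move=> CK; apply: (@le_trans _ _ (((4 * pi ^+ 2)^-1)%:E * K%:E)%E).
    by apply: lee_wpmul2l => //; rewrite lee_fin invr_ge0 mulr_ge0// sqr_ge0.
  have alg (p n : R) : p != 0 -> n != 0 ->
      (4 * p ^+ 2)^-1 * (8 * p ^+ 2 + 8 * p ^+ 4 / n) = 2 + 2 * p ^+ 2 / n.
    by move=> p0 n0; field; rewrite p0 n0.
  by rewrite -EFinM /K alg.
have [AK|BK] : (A <= K%:E)%E \/ (B <= K%:E)%E.
  have [AK|KA] := leP A K%:E; [by left|right].
  rewrite leNgt; apply/negP => KB.
  move: ABK; rewrite leNgt => /negP; apply.
  by rewrite -EFinM mulr2n mulrDl mul1r EFinD; apply: lteD.
- exists 1; split; first by left.
  rewrite Hhalf_cis; apply: fin; apply: le_trans AK.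
  rewrite (_ : uphase L 1 N.+1 = fun x => bphase L^-1 L x + pi * plateau N.+1 x)//.
  by apply/funext => x; rewrite /uphase mul1r.
- exists (-1); split; first by right.
  rewrite Hhalf_cis; apply: fin; apply: le_trans BK.
  rewrite (_ : uphase L (-1) N.+1 = fun x => bphase L^-1 L x - pi * plateau N.+1 x)//.
  by apply/funext => x; rewrite /uphase mulN1r.
Qed.

Lemma atan_lipschitz (x y : R) : `|atan x - atan y| <= `|x - y|.
Proof.
wlog xy : x y / y <= x.
  move=> H; have [|/ltW xy] := leP y x; first exact: H.
  by rewrite distrC (distrC x); exact: H.
have datan z : z \in `]y, x[ -> is_derive z 1 atan (1 + z ^+ 2)^-1.
  by move=> _; exact: is_derive1_atan.
have [|c _ ->] := MVT_segment xy datan.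
  by apply: continuous_subspaceT => z; exact: continuous_atan.
rewrite normrM ler_piMl// ger0_norm ?invr_ge0 ?addr_ge0 ?sqr_ge0//.
by rewrite invf_le1 ?lerDl ?sqr_ge0// ltr_pwDl// sqr_ge0.
Qed.

Lemma plateau_ge0 N (x : R) : 0 <= plateau N.+1 x.
Proof.
rewrite mulr_ge0// sumr_ge0// => j _.
by rewrite divr_ge0// ?addr_ge0 ?sqr_ge0.
Qed.

Lemma plateau_far N : exists2 T : R, 0 <= T & forall x, 0 < x -> plateau N.+1 x <= T / x ^+ 2.
Proof.
exists (N.+1%:R^-1 * \sum_(j < N.+1) (N.+1%:R ^+ j) ^+ 2).
  by rewrite mulr_ge0// sumr_ge0// => j _; rewrite sqr_ge0.
move=> x x0; rewrite -mulrA ler_pM2l// mulr_suml; apply: ler_sum => j _.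
apply: ler_wpM2l; first exact: sqr_ge0.
by rewrite lef_pV2 ?posrE ?exprn_gt0 ?sqrD_gt0 ?exprn_gt0// lerDl sqr_ge0.
Qed.

Lemma plateau_near N (x : R) : 1 - x ^+ 2 <= plateau N.+1 x <= 1.
Proof.
have N0 : 0 < N.+1%:R :> R by [].
have S c : \sum_(j < N.+1) c = N.+1%:R * c :> R.
  by rewrite sumr_const card_ord mulr_natl.
have L1 j : 1 <= (N.+1%:R ^+ j) ^+ 2 :> R by rewrite !exprn_ege1// ler1n.
have L0 (j : nat) : 0 < x ^+ 2 + (N.+1%:R ^+ j) ^+ 2.
  by rewrite sqrD_gt0// exprn_gt0.
rewrite /plateau -(ler_pM2l N0) -[X in _ && X](ler_pM2l N0) !mulVKf ?gt_eqF// -!S.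
apply/andP; split; apply: ler_sum => j _.
  rewrite ler_pdivlMr//; have := L1 j; have := sqr_ge0 x.
  set t := x ^+ 2; set l := (_ ^+ j) ^+ 2 => t0 l1; nra.
by rewrite ler_pdivrMr// mul1r lerDr sqr_ge0.
Qed.

(** At both extreme scales the candidate looks like the degree one map
    [X |-> (X - i) / (X + i)]: the half turn of the plateau cancels the sign
    that the other factor takes there. *)
Lemma uphase_approx N (k : R) : 0 < k ->
  exists2 L : R, 1 < L /\ 1 <= k * L & forall s X,
  s = 1 \/ s = -1 -> 1 <= X <= 6 -> forall x, x = L * X \/ x = L^-1 * X ->
  `|cos (uphase L s N.+1 x) - (X ^+ 2 - 1) / (X ^+ 2 + 1)| <= k /\
  `|sin (uphase L s N.+1 x) - (- 2 * X) / (X ^+ 2 + 1)| <= k.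
Proof.
move=> k0; have [T T0 HT] := plateau_far N.
have pi0 := pi_gt0 R.
have k2 : 0 < k / 4 by rewrite divr_gt0.
have /cvgrPdist_le /(_ _ k2) atanL := @cvgy_atan R.
(* The three summands make the tail of the plateau, the arctangent of [X / L^2]
   and the defect of the plateau near 0 each at most [k / 4]. *)
pose M := 1 + (pi * T * 4 + 48 + 36 * pi * 4) / k.
have [L [L2 LM aL]] : exists L, [/\ 1 < L, M <= L & `|pi / 2 - atan L| <= k / 4].
  have [L [H1 H2]] : exists L, `|pi / 2 - atan L| <= k / 4 /\ M + 2 <= L.
    near (pinfty_nbhs R) => L; exists L; split; near: L; first exact: atanL.
    by apply: nbhs_pinfty_ge; rewrite num_real.
  have M1 : 1 <= M.
    by rewrite lerDl divr_ge0// ?addr_ge0// ?mulr_ge0// ltW.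
  by exists L; split => //; lra.
have L0 : 0 < L by lra.
have kL : pi * T * 4 + 48 + 36 * pi * 4 <= k * L.
  by move: LM; rewrite /M -lerBrDl ler_pdivrMr//; nra.
exists L => [|s X ss /andP[X1 X6] x xE].
  split=> //; have : 0 <= pi * T :> R by rewrite mulr_ge0// ltW.
  lra.
have X0 : 0 < X by lra.
have LL : L <= L ^+ 2 by rewrite expr2 ler_peMl// ltW.
(* A half turn of either orientation, and an error [d] in the phase. *)
have aux d : `|d| <= k -> (uphase L s N.+1 x = 2 * atan X + pi + d \/
    uphase L s N.+1 x = 2 * atan X - pi + d) ->
  `|cos (uphase L s N.+1 x) - (X ^+ 2 - 1) / (X ^+ 2 + 1)| <= k /\
  `|sin (uphase L s N.+1 x) - (- 2 * X) / (X ^+ 2 + 1)| <= k.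
  move=> dk E.
  have cE : (X ^+ 2 - 1) / (X ^+ 2 + 1) = - cos (2 * atan X).
    by rewrite cos_2atan -mulNr opprB addrC (addrC 1).
  have sE : (- 2 * X) / (X ^+ 2 + 1) = - sin (2 * atan X).
    by rewrite sin_2atan -mulNr -mulNr addrC (addrC 1).
  rewrite cE sE; case: E => ->.
    rewrite -cosDpi -sinDpi; split; apply: le_trans dk.
      by apply: le_trans (cos_lipschitz _ _) _; rewrite addrAC subrr add0r.
    by apply: le_trans (sin_lipschitz _ _) _; rewrite addrAC subrr add0r.
  have cB y : - cos y = cos (y - pi) :> R.
    by rewrite -{1}(subrK pi y) cosDpi opprK.
  have sB y : - sin y = sin (y - pi) :> R.
    by rewrite -{1}(subrK pi y) sinDpi opprK.
  rewrite cB sB; split; apply: le_trans dk.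
    by apply: le_trans (cos_lipschitz _ _) _; rewrite addrAC subrr add0r.
  by apply: le_trans (sin_lipschitz _ _) _; rewrite addrAC subrr add0r.
have sN : `|s| = 1 by case: ss => ->; rewrite ?normrN normr1.
case: xE => xE.
- apply: (aux (2 * (atan (L ^+ 2 * X) - pi / 2) + s * (pi * plateau N.+1 x))); last first.
    left; rewrite /uphase /bphase xE invrK.
    rewrite (_ : L * X * L = L ^+ 2 * X); last by ring.
    by rewrite (_ : L * X / L = X); [field|field; rewrite gt_eqF].
  apply: le_trans (ler_normD _ _) _.
  rewrite (normrM 2) (normrM s) (normrM pi) sN mul1r (gtr0_norm pi0).
  rewrite (ger0_norm (plateau_ge0 _ _)) (ger0_norm (ler0n R 2)).
  have h1 : `|atan (L ^+ 2 * X) - pi / 2| <= k / 4.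
    rewrite distrC ger0_norm; last by rewrite subr_ge0 ltW// atan_ltpi2.
    apply: le_trans aL; rewrite [leRHS]ger0_norm; last by rewrite subr_ge0 ltW// atan_ltpi2.
    rewrite lerD2l lerN2; apply: le_atan; nra.
  have h2 : pi * plateau N.+1 x <= k / 4.
    have x0 : 0 < x by rewrite xE mulr_gt0.
    have := HT x x0 => H.
    apply: (@le_trans _ _ (pi * (T / x ^+ 2))); first by rewrite ler_pM2l.
    rewrite mulrA ler_pdivrMr ?exprn_gt0//.
    have : L <= x ^+ 2.
      by rewrite xE exprMn; nra.
    nra.
  lra.
- apply: (aux (2 * atan (X / L ^+ 2) + s * (pi * (plateau N.+1 x - 1)))); last first.
    have E1 : uphase L s N.+1 x = 2 * atan X + 2 * atan (X / L ^+ 2) + s * (pi * plateau N.+1 x).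
      rewrite /uphase /bphase xE invrK.
      rewrite (_ : L^-1 * X * L = X); last by field; rewrite gt_eqF.
      by rewrite (_ : L^-1 * X / L = X / L ^+ 2)//; field; rewrite gt_eqF.
    by case: ss => sE; [left|right]; rewrite E1 sE; ring.
  apply: le_trans (ler_normD _ _) _.
  rewrite (normrM 2) (normrM s) (normrM pi) sN mul1r (gtr0_norm pi0).
  rewrite (ger0_norm (ler0n R 2)).
  have L20 : 0 < L ^+ 2 by rewrite exprn_gt0.
  have h1 : `|atan (X / L ^+ 2)| <= k / 4.
    have := atan_lipschitz (X / L ^+ 2) 0; rewrite atan0 !subr0 => H.
    apply: le_trans H _; rewrite ger0_norm; last by rewrite divr_ge0// ltW.
    by rewrite ler_pdivrMr//; nra.
  have h2 : pi * `|plateau N.+1 x - 1| <= k / 4.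
    have /andP[p1 p2] := plateau_near N x.
    rewrite distrC ger0_norm ?subr_ge0//.
    apply: (@le_trans _ _ (pi * x ^+ 2)); first by rewrite ler_pM2l//; lra.
    rewrite xE exprMn exprVn mulrCA mulrC ler_pdivrMr//.
    have XX : X ^+ 2 <= 36 by nra.
    have pX : pi * X ^+ 2 <= pi * 36 :> R by rewrite ler_pM2l.
    have kLL : k / 4 * L <= k / 4 * L ^+ 2 by rewrite ler_pM2l.
    have pT : 0 <= pi * T by rewrite mulr_ge0// ltW.
    by apply: (le_trans pX); apply: le_trans kLL; lra.
  lra.
Unshelve. all: by end_near. Qed.

End Candidate.

(** * Sampling a double integral *)

Section Sampling.
Context {R : realType}.
Local Notation mu := (@lebesgue_measure R).
Local Notation mu2 := ((mu \x mu)%E).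

Lemma integral_ge_const (G : R -> \bar R) (a b c : R) : a <= b -> 0 <= c ->
    measurable_fun [set: R] G -> (forall x, 0 <= G x)%E ->
    (forall x, x \in `[a, b] -> c%:E <= G x)%E ->
  ((c * (b - a))%:E <= \int[mu]_x G x)%E.
Proof.
move=> ab c0 mG G0 Gc.
have : (\int[mu]_(x in `[a, b]) G x <= \int[mu]_x G x)%E.
  by apply: ge0_subset_integral.
apply: le_trans.
have -> : ((c * (b - a))%:E = \int[mu]_(x in `[a, b]) c%:E)%E.
  by rewrite integral_cst//= lebesgue_measure_itv/= lte_fin; case: ltP => [|ba];
    rewrite ?EFinM// (_ : b = a) ?subrr ?mulr0 ?mule0//; apply/eqP; rewrite eq_le ba.
apply: ge0_le_integral => //.
exact: measurable_funTS.
Qed.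

(** If there were no such triple, then for every [x1] one of the inner integrals,
    over [[3l, 4l]] or over [[5l, 6l]], would be at least [c l]. *)
Lemma exists_small_triple (F : R * R -> R) (l c : R) : 0 < l -> 0 < c ->
    measurable_fun [set: R * R] F -> (forall z, 0 <= F z) ->
    (\int[mu2]_z (F z)%:E < (c * l ^+ 2)%:E)%E ->
  exists x1 x2 x3, [/\ x1 \in `[l, 2 * l], x2 \in `[3 * l, 4 * l],
     x3 \in `[5 * l, 6 * l], F (x1, x2) < c & F (x1, x3) < c].
Proof.
move=> l0 c0 mF F0 small; apply: contrapT => none.
have mEF : measurable_fun [set: R * R] (EFin \o F) by exact/measurable_EFinP.
have F0' z : (0 <= (EFin \o F) z)%E by rewrite lee_fin.
suff : ((c * l ^+ 2)%:E <= \int[mu2]_z (F z)%:E)%E by rewrite leNgt small.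
rewrite fubini_tonelli1//.
have -> : c * l ^+ 2 = (c * l) * (2 * l - l) by ring.
apply: integral_ge_const.
- lra.
- by rewrite mulr_ge0// ltW.
- exact: measurable_fun_fubini_tonelli_F.
- by move=> x; apply: integral_ge0 => y _; exact: F0'.
move=> x xI.
have mFx : measurable_fun [set: R] (fun y => F (x, y)).
  exact: (measurableT_comp mF).
have [H2|/existsNP[x2 /not_implyP[J2 /negP]]] :=
    pselect (forall y, y \in `[3 * l, 4 * l] -> c <= F (x, y)).
  have -> : c * l = c * (4 * l - 3 * l) by ring.
  by apply: integral_ge_const => //; [lra|exact: ltW|exact/measurable_EFinP|move=> y; exact: F0'].
rewrite -ltNge => Fx2.
have [H3|/existsNP[x3 /not_implyP[J3 /negP]]] :=
    pselect (forall y, y \in `[5 * l, 6 * l] -> c <= F (x, y)).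
  have -> : c * l = c * (6 * l - 5 * l) by ring.
  by apply: integral_ge_const => //; [lra|exact: ltW|exact/measurable_EFinP|move=> y; exact: F0'].
rewrite -ltNge => Fx3.
by exfalso; apply: none; exists x, x2, x3.
Qed.

End Sampling.

(** * Rigidity of quadratic phases at two scales *)

Section Rigidity.
Context {R : realType}.
Implicit Types (X k e : R).

Lemma sqr_sum1_norm_le1 (s t : R) : s ^+ 2 + t ^+ 2 = 1 -> `|s| <= 1.
Proof. by move=> st; have t0 := sqr_ge0 t; rewrite ler_norml; apply/andP; split; nra. Qed.

Lemma sqr_sum_norm_le (s t k : R) : 0 <= k -> s ^+ 2 + t ^+ 2 <= k ^+ 2 -> `|s| <= k.
Proof. by move=> k0 st; have t0 := sqr_ge0 t; rewrite ler_norml; apply/andP; split; nra. Qed.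

Lemma sample_range (Z : 'I_3 -> R) i :
  1 <= Z 0 <= 2 -> 3 <= Z 1 <= 4 -> 5 <= Z 2 <= 6 -> 1 <= Z i <= 6.
Proof.
have [->|->|->] : [\/ i = 0, i = 1 | i = 2].
  by case: i => -[|[|[|//]]] ?;
    [constructor 1|constructor 2|constructor 3]; exact: val_inj.
- by move=> /andP[a b] _ _; apply/andP; split; lra.
- by move=> _ /andP[a b] _; apply/andP; split; lra.
- by move=> _ _ /andP[a b]; apply/andP; split; lra.
Qed.

(** Lagrange interpolation: the nodes are 1-separated, so the coefficients of a
    quadratic polynomial are controlled by its values at the nodes. *)
Lemma quadratic_coef_le X1 X2 X3 p r s k :
    1 <= X1 <= 2 -> 3 <= X2 <= 4 -> 5 <= X3 <= 6 ->
    `|p * X1 ^+ 2 + r * X1 + s| <= k -> `|p * X2 ^+ 2 + r * X2 + s| <= k ->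
    `|p * X3 ^+ 2 + r * X3 + s| <= k ->
  [/\ `|p| <= 100 * k, `|r| <= 100 * k & `|s| <= 100 * k].
Proof.
move=> /andP[a1 b1] /andP[a2 b2] /andP[a3 b3].
rewrite !ler_norml => /andP[l1 u1] /andP[l2 u2] /andP[l3 u3].
have k0 : 0 <= k by lra.
have d12 : - (2 * k) <= p * (X1 + X2) + r <= 2 * k by apply/andP; split; nra.
have d23 : - (2 * k) <= p * (X2 + X3) + r <= 2 * k by apply/andP; split; nra.
move: d12 d23 => /andP[l12 u12] /andP[l23 u23].
have hp : - (2 * k) <= p <= 2 * k by apply/andP; split; nra.
move: hp => /andP[lp up].
have box t m : 0 <= t <= m -> - (2 * k * m) <= p * t <= 2 * k * m.
  by move=> /andP[t0 tm]; apply/andP; split; nra.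
have /andP[v1 v2] : - (2 * k * 6) <= p * (X1 + X2) <= 2 * k * 6.
  by apply: box; apply/andP; split; lra.
have hr : - (14 * k) <= r <= 14 * k by apply/andP; split; lra.
move: hr => /andP[lr ur].
have /andP[w1 w2] : - (2 * k * 4) <= p * X1 ^+ 2 <= 2 * k * 4.
  by apply: box; apply/andP; split; nra.
have /andP[z1 z2] : - (28 * k) <= r * X1 <= 28 * k.
  by apply/andP; split; nra.
have hs : - (37 * k) <= s <= 37 * k by apply/andP; split; lra.
move: hs => /andP[ls us].
by clear -k0 lp up lr ur ls us; split; apply/andP; split; lra.
Qed.

Let blaschke_re X := (X ^+ 2 - 1) / (X ^+ 2 + 1).
Let blaschke_im X := (- 2 * X) / (X ^+ 2 + 1).

(** A unimodular [p + iq] differing from a unimodular [u + iv] by nearly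
    [a + ic] forces a relation on [a + ic], which is quadratic in [X] when
    [u + iv] is the value at [X] of the degree one map. *)
Lemma unit_shift_quadratic X u v p q a c k :
    1 <= X <= 6 -> 0 <= k -> u ^+ 2 + v ^+ 2 = 1 -> p ^+ 2 + q ^+ 2 = 1 ->
    `|a| <= 2 -> `|c| <= 2 ->
    `|u - blaschke_re X| <= k -> `|v - blaschke_im X| <= k ->
    `|u - p - a| <= k -> `|v - q - c| <= k ->
  `|(a - (a ^+ 2 + c ^+ 2) / 2) * X ^+ 2 + (- 2 * c) * X
      + - (a + (a ^+ 2 + c ^+ 2) / 2)| <= 37 * 10 * k.
Proof.
move=> /andP[X1 X6] k0 uv pq a2 c2 ub vb ua vc.
pose d := X ^+ 2 + 1.
have d0 : 0 < d by rewrite ltr_wpDl ?sqr_ge0.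
have d37 : d <= 37 by rewrite /d; nra.
have sq1 := @sqr_sum1_norm_le1.
have u1 := sq1 _ _ uv; have p1 := sq1 _ _ pq.
have v1 : `|v| <= 1 by apply: (sq1 v u); rewrite addrC.
have q1 : `|q| <= 1 by apply: (sq1 q p); rewrite addrC.
have bb : blaschke_re X ^+ 2 + blaschke_im X ^+ 2 = 1.
  by rewrite /blaschke_re /blaschke_im -/d /d; field; rewrite gt_eqF.
have b1 := sq1 _ _ bb.
have b2 : `|blaschke_im X| <= 1 by apply: (sq1 _ (blaschke_re X)); rewrite addrC.
have -> : (a - (a ^+ 2 + c ^+ 2) / 2) * X ^+ 2 + (- 2 * c) * X
      + - (a + (a ^+ 2 + c ^+ 2) / 2) =
   d * (blaschke_re X * a + blaschke_im X * c - (a ^+ 2 + c ^+ 2) / 2).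
  by rewrite /blaschke_re /blaschke_im -/d /d; field; rewrite gt_eqF.
rewrite normrM (gtr0_norm d0) -mulrA.
suff H : `|blaschke_re X * a + blaschke_im X * c - (a ^+ 2 + c ^+ 2) / 2| <= 10 * k.
  by apply: ler_pM => //; exact: ltW.
set f := u - p; set g := v - q.
have key : u * f + v * g - (f ^+ 2 + g ^+ 2) / 2 = 0 by rewrite /f /g; nra.
have -> : blaschke_re X * a + blaschke_im X * c - (a ^+ 2 + c ^+ 2) / 2 =
    (blaschke_re X - u) * a + u * (a - f) + ((blaschke_im X - v) * c + v * (c - g))
    + (f - a) * (f + a) / 2 + (g - c) * (g + c) / 2
    + (u * f + v * g - (f ^+ 2 + g ^+ 2) / 2) by field.
rewrite key addr0.
have f2 : `|f + a| <= 4.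
  by apply: le_trans (ler_normD _ _) _; have := ler_normB u p; rewrite -/f; lra.
have g2 : `|g + c| <= 4.
  by apply: le_trans (ler_normD _ _) _; have := ler_normB v q; rewrite -/g; lra.
have bound (s t m n : R) : `|s| <= m -> `|t| <= n -> `|s * t| <= m * n.
  by move=> sm tn; rewrite normrM ler_pM.
rewrite distrC in ub; rewrite distrC in vb.
have e1 := bound _ _ _ _ ub a2.
have e2 := bound _ _ _ _ vb c2.
have ua' := ua; rewrite distrC in ua'.
have vc' := vc; rewrite distrC in vc'.
have e3 := bound _ _ _ _ u1 ua'; rewrite -/f in e3.
have e4 := bound _ _ _ _ v1 vc'; rewrite -/g in e4.
have e5 := bound _ _ _ _ ua f2; rewrite -/f in e5.
have e6 := bound _ _ _ _ vc g2; rewrite -/g in e6.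
move: e1 e2 e3 e4 e5 e6; rewrite !ler_norml => /andP[l1 h1] /andP[l2 h2] /andP[l3 h3].
move=> /andP[l4 h4] /andP[l5 h5] /andP[l6 h6].
clear -k0 l1 h1 l2 h2 l3 h3 l4 h4 l5 h5 l6 h6.
by apply/andP; split; lra.
Qed.

(** If [p + iq] is the value at [X] of a polynomial [P], the hypotheses say that
    [P / conj P] is close to [(X - i) / (X + i)], and [p + q X] is the imaginary
    part of [P (X + i)]. *)
Lemma phase_match X p q s t e : 1 <= X <= 6 -> 0 <= e ->
    p = s * p + t * q -> q = t * p - s * q ->
    `|s - blaschke_re X| <= e -> `|t - blaschke_im X| <= e ->
  `|p + q * X| <= 4 * e * (`|p| + `|q|).
Proof.
move=> /andP[X1 X6] e0 pE qE se te.
pose d := X ^+ 2 + 1.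
have d0 : 0 < d by rewrite ltr_wpDl ?sqr_ge0.
have dX : d <= 4 * (2 * X) by rewrite /d; nra.
have X0 : 0 < 2 * X by lra.
have E : p + q * X = d / (2 * X) * ((t - blaschke_im X) * p - (s - blaschke_re X) * q).
  have -> : (t - blaschke_im X) * p - (s - blaschke_re X) * q =
     (t * p - s * q) - (blaschke_im X * p - blaschke_re X * q) by ring.
  rewrite -qE /blaschke_im /blaschke_re -/d /d; field.
  by rewrite !gt_eqF//; lra.
have dX0 : 0 <= d / (2 * X) by apply: divr_ge0; exact: ltW.
rewrite E normrM (ger0_norm dX0) -[leRHS]mulrA.
apply: ler_pM => //.
  by rewrite ler_pdivrMr.
apply: le_trans (ler_normB _ _) _; rewrite !normrM mulrDr.
by apply: lerD; apply: ler_wpM2r.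
Qed.


Lemma quadratic_size_le (a b c x m1 m3 : R) :
  1 <= x <= 6 -> 0 <= m1 <= 1 -> 0 <= m3 <= 1 ->
`|m1 * a * x ^+ 2 + b * x + m3 * c| <= 36 * (`|a| + `|b| + `|c|).
Proof.
move=> /andP[u v] /andP[m10 m11] /andP[m30 m31].
apply: le_trans (ler_normD _ _) _; apply: le_trans (lerD (ler_normD _ _) (lexx _)) _.
have x0' : 0 <= x by apply: le_trans u.
rewrite (normrM _ (x ^+ 2)) (normrM m1) (normrM b) (normrM m3).
rewrite (ger0_norm m10) (ger0_norm m30) (ger0_norm (sqr_ge0 x)) (ger0_norm x0').
have [[ha hb] hc] := (normr_ge0 a, normr_ge0 b, normr_ge0 c).
have t1 : m1 * `|a| <= `|a| by rewrite ler_piMl.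
have t0 : 0 <= m1 * `|a| by rewrite mulr_ge0.
have t2 : x ^+ 2 <= 36 by nra.
have t3 : m1 * `|a| * x ^+ 2 <= `|a| * 36.
  by apply: ler_pM => //; exact: sqr_ge0.
have t4 : `|b| * x <= `|b| * 36 by apply: ler_wpM2l => //; lra.
have t5 : m3 * `|c| <= `|c| by rewrite ler_piMl.
lra.
Qed.

(** Let [P x = A x^2 + B x + h C] with [A = A1 + i A2] and so on. At the unit
    scale, and after [x = h y], the values of [P] are those of the two quadratic
    polynomials below, the second one divided by [h]. For [h = e = 0] the
    hypotheses say that [A2 x^2 + (A1 + B2) x + B1] and
    [B2 y^2 + (B1 + C2) y + C1] vanish at three points each, which leaves only
    [P = 0]; small [h] and [e] perturb an invertible system. *)
Lemma two_scale_rigidity (A1 A2 B1 B2 C1 C2 h e : R) (X Y : 'I_3 -> R) :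
    0 <= h <= 1 -> 0 <= e -> 8 * (100 * (144 * e + 216 * h)) < 1 ->
    1 <= X 0 <= 2 -> 3 <= X 1 <= 4 -> 5 <= X 2 <= 6 ->
    1 <= Y 0 <= 2 -> 3 <= Y 1 <= 4 -> 5 <= Y 2 <= 6 ->
    (forall i x p q, x = X i ->
       p = A1 * x ^+ 2 + B1 * x + h * C1 -> q = A2 * x ^+ 2 + B2 * x + h * C2 ->
       `|p + q * x| <= 4 * e * (`|p| + `|q|)) ->
    (forall i y p q, y = Y i ->
       p = h * A1 * y ^+ 2 + B1 * y + C1 -> q = h * A2 * y ^+ 2 + B2 * y + C2 ->
       `|p + q * y| <= 4 * e * (`|p| + `|q|)) ->
  A1 = 0 /\ A2 = 0.
Proof.
move=> /andP[h0 h1] e0 small x0 x1 x2 y0 y1 y2 HX HY.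
pose S := `|A1| + `|A2| + (`|B1| + `|B2|) + (`|C1| + `|C2|).
have [a1 a2] := (normr_ge0 A1, normr_ge0 A2).
have [b1 b2] := (normr_ge0 B1, normr_ge0 B2).
have [c1 c2] := (normr_ge0 C1, normr_ge0 C2).
have S0 : 0 <= S by rewrite /S; lra.
have [C1S C2S] : `|C1| <= S /\ `|C2| <= S by rewrite /S; split; lra.
(* [144 e] is [4 e] times the bound 36 on the size of [P], and [216 = 6^3]
   bounds the cubic term that [h] multiplies. *)
pose E := (144 * e + 216 * h) * S.
have size := quadratic_size_le.
have QX i : `|A2 * X i ^+ 2 + (A1 + B2) * X i + B1| <= E.
  have /andP[u v] := sample_range i x0 x1 x2.
  have /= := HX i (X i) _ _ erefl erefl erefl.
  set p := A1 * _ + _ + _; set q := A2 * _ + _ + _ => pq.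
  have pS : `|p| <= 36 * (`|A1| + `|B1| + `|C1|).
    have := size A1 B1 C1 (X i) 1 h; rewrite mul1r; apply; by rewrite ?u ?v ?ler01 ?lexx ?h0.
  have qS : `|q| <= 36 * (`|A2| + `|B2| + `|C2|).
    have := size A2 B2 C2 (X i) 1 h; rewrite mul1r; apply; by rewrite ?u ?v ?ler01 ?lexx ?h0.
  have pqS : `|p + q * X i| <= 144 * e * S.
    apply: le_trans pq _.
    have -> : 144 * e * S = 4 * e * (36 * S) by ring.
    by apply: ler_wpM2l; [rewrite mulr_ge0|rewrite /S; lra].
  have X0 : 0 < X i := lt_le_trans ltr01 u.
  rewrite -(ler_pM2l X0) -{1}(gtr0_norm X0) -normrM.
  have -> : X i * (A2 * X i ^+ 2 + (A1 + B2) * X i + B1) =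
    (p + q * X i) - h * C2 * X i - h * C1 by rewrite /p /q; ring.
  apply: le_trans (ler_normB _ _) _; apply: le_trans (lerD (ler_normB _ _) (lexx _)) _.
  rewrite !normrM (ger0_norm h0) (gtr0_norm X0).
  have hS1 : h * `|C1| <= h * S := ler_wpM2l h0 C1S.
  have hS2 : h * `|C2| <= h * S := ler_wpM2l h0 C2S.
  have eS : 0 <= 144 * e * S by rewrite mulr_ge0// mulr_ge0.
  have hS : 0 <= h * S by rewrite mulr_ge0.
  have hSX : h * `|C2| * X i <= h * S * X i by rewrite ler_pM2r.
  rewrite /E; nra.
have QY i : `|B2 * Y i ^+ 2 + (B1 + C2) * Y i + C1| <= E.
  have yi := sample_range i y0 y1 y2; have /andP[u v] := yi.
  have /= := HY i (Y i) _ _ erefl erefl erefl.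
  set p := h * A1 * _ + _ + _; set q := h * A2 * _ + _ + _ => pq.
  have pS : `|p| <= 36 * (`|A1| + `|B1| + `|C1|).
    have := size A1 B1 C1 (Y i) h 1; rewrite mul1r; apply; by rewrite ?u ?v ?ler01 ?lexx ?h0.
  have qS : `|q| <= 36 * (`|A2| + `|B2| + `|C2|).
    have := size A2 B2 C2 (Y i) h 1; rewrite mul1r; apply; by rewrite ?u ?v ?ler01 ?lexx ?h0.
  have pqS : `|p + q * Y i| <= 144 * e * S.
    apply: le_trans pq _.
    have -> : 144 * e * S = 4 * e * (36 * S) by ring.
    by apply: ler_wpM2l; [rewrite mulr_ge0|rewrite /S; lra].
  have -> : B2 * Y i ^+ 2 + (B1 + C2) * Y i + C1 =
    (p + q * Y i) - h * (Y i ^+ 2 * (A1 + A2 * Y i)) by rewrite /p /q; ring.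
  apply: le_trans (ler_normB _ _) _.
  rewrite (normrM h) (ger0_norm h0) normrM (ger0_norm (sqr_ge0 _)).
  have -> : E = 144 * e * S + h * (36 * (6 * S)) by rewrite /E; ring.
  apply: lerD => //; apply: ler_wpM2l => //.
  apply: ler_pM => //; [exact: sqr_ge0|by nra|].
  apply: le_trans (ler_normD _ _) _; rewrite normrM (@ger0_norm _ (Y i)); last lra.
  have : `|A2| * Y i <= `|A2| * 6 by apply: ler_wpM2l.
  rewrite /S; lra.
have [m1 m2 m3] := quadratic_coef_le x0 x1 x2 (QX 0) (QX 1) (QX 2).
have [n1 n2 n3] := quadratic_coef_le y0 y1 y2 (QY 0) (QY 1) (QY 2).
have A1S : `|A1| <= `|A1 + B2| + `|B2| by rewrite -{1}(addrK B2 A1) ler_normB.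
have C2B : `|C2| <= `|B1 + C2| + `|B1| by rewrite -{1}(addKr B1 C2) addrC ler_normB.
have SE : S <= 8 * (100 * E).
  clear -A1S C2B m1 m2 m3 n1 n2 n3; rewrite /S; lra.
have S00 : S = 0.
  apply/eqP; rewrite eq_le S0 andbT leNgt; apply/negP => Sp.
  move: SE; rewrite /E !mulrA -!mulrA mulrA leNgt => /negP; apply.
  have -> : 8 * 100 * ((144 * e + 216 * h) * S) = (8 * (100 * (144 * e + 216 * h))) * S by ring.
  by rewrite gtr_pMl.
clear -S00 a1 a2 b1 b2 c1 c2.
by split; apply/eqP; rewrite -normr_le0; move: S00; rewrite /S; lra.
Qed.

End Rigidity.

(** * Complex-valued maps and Blaschke products *)

Section BlaschkeProducts.
Context {R : realType}.
Local Notation mu := (@lebesgue_measure R).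
Local Notation mu2 := ((mu \x mu)%E).
Local Notation C := R[i].

Lemma cmeasurableM (f g : R -> C) : cmeasurable f -> cmeasurable g ->
  cmeasurable (fun x => f x * g x).
Proof.
move=> [f1 f2] [g1 g2]; split.
  rewrite (_ : (fun _ => _) = (fun x => complex.Re (f x) * complex.Re (g x)
    - complex.Im (f x) * complex.Im (g x))); last first.
    by apply/funext => x; case: (f x) (g x) => a b [c d].
  by apply: measurable_funB; apply: measurable_funM.
rewrite (_ : (fun _ => _) = (fun x => complex.Re (f x) * complex.Im (g x)
    + complex.Im (f x) * complex.Re (g x))); last first.
  by apply/funext => x; case: (f x) (g x) => a b [c d].
by apply: measurable_funD; apply: measurable_funM.
Qed.

Lemma cmeasurableB (f g : R -> C) : cmeasurable f -> cmeasurable g ->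
  cmeasurable (fun x => f x - g x).
Proof.
move=> [f1 f2] [g1 g2]; split.
  rewrite (_ : (fun _ => _) = (fun x => complex.Re (f x) - complex.Re (g x))).
    exact: measurable_funB.
  by apply/funext => x; case: (f x) (g x) => a b [c d].
rewrite (_ : (fun _ => _) = (fun x => complex.Im (f x) - complex.Im (g x))).
  exact: measurable_funB.
by apply/funext => x; case: (f x) (g x) => a b [c d].
Qed.

Lemma cmeasurableV (f : R -> C) : cmeasurable f -> cmeasurable (fun x => (f x)^-1).
Proof.
move=> [f1 f2].
have mN : measurable_fun [set: R]
    (fun x => (complex.Re (f x) ^+ 2 + complex.Im (f x) ^+ 2)^-1).
  apply: (measurableT_comp measurable_inv).
  by apply: measurable_funD; apply: measurable_funX.
split.
  rewrite (_ : (fun _ => _) = (fun x => complex.Re (f x) *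
     (complex.Re (f x) ^+ 2 + complex.Im (f x) ^+ 2)^-1)).
    exact: measurable_funM.
  by apply/funext => x; case: (f x) => a b.
rewrite (_ : (fun _ => _) = (fun x => - complex.Im (f x) *
   (complex.Re (f x) ^+ 2 + complex.Im (f x) ^+ 2)^-1)).
  by apply: measurable_funM => //; exact: measurable_funN.
by apply/funext => x; case: (f x) => a b /=; rewrite mulNr.
Qed.

Lemma cmeasurable_cst (z : C) : cmeasurable (fun=> z).
Proof. by split; exact: measurable_cst. Qed.

Lemma cmeasurable_real : cmeasurable (fun x : R => x%:C).
Proof. by split => /=; [exact: measurable_id|exact: measurable_cst]. Qed.

Lemma cmeasurable_psi theta a : cmeasurable (@psi R theta a).
Proof.
have lin z := cmeasurableB cmeasurable_real (cmeasurable_cst z).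
have H z := cmeasurableM (lin z) (cmeasurableV (lin (conjc z))).
exact: cmeasurableM (cmeasurableM (cmeasurable_cst _) (H a.1)) (H a.2).
Qed.

Lemma cmeasurable_cis (f : R -> R) : continuous f -> cmeasurable (fun x => cis (f x)).
Proof.
move=> cf; have mf : measurable_fun [set: R] f by exact: continuous_measurable_fun.
split => /=.
  by apply: measurableT_comp mf; exact: continuous_measurable_fun (@continuous_cos R).
by apply: measurableT_comp mf; exact: continuous_measurable_fun (@continuous_sin R).
Qed.

Lemma measurable_diff_quot (f : R -> C) : cmeasurable f ->
  measurable_fun [set: R * R]
    (fun z => cabs (f z.1 - f z.2) ^+ 2 / `|z.1 - z.2| ^+ 2).
Proof.
move=> [f1 f2].
have sq (g : R -> R) : measurable_fun [set: R] g ->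
    measurable_fun [set: R * R] (fun z => (g z.1 - g z.2) ^+ 2).
  by move=> mg; apply: measurable_funX; apply: measurable_funB; exact: measurableT_comp.
rewrite (_ : (fun _ => _) = (fun z =>
  ((complex.Re (f z.1) - complex.Re (f z.2)) ^+ 2 +
   (complex.Im (f z.1) - complex.Im (f z.2)) ^+ 2) * ((z.1 - z.2) ^+ 2)^-1)).
  apply: measurable_funM.
    exact: (measurable_funD (sq _ f1) (sq _ f2)).
  apply: (measurableT_comp measurable_inv).
  by apply: measurable_funX; apply: measurable_funB.
apply/funext => z; rewrite cabs_sqr real_normK ?num_real//.
by case: (f z.1) (f z.2) => a b [c d].
Qed.

Lemma cis_half (t : R) : cis t = cis (t / 2) * cis (t / 2) :> C.
Proof.
have -> : cis t = cis (t / 2 + t / 2) :> C by congr cis; field.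
by rewrite /cis cosD sinD; simpc; congr (_ +i* _); rewrite addrC (mulrC (cos _) (sin _)).
Qed.

Lemma cis_conj (t : R) : cis t * conjc (cis t) = 1 :> C.
Proof.
rewrite /cis /=; simpc; rewrite -!expr2 cos2Dsin2 mulrC addNr.
by [].
Qed.

Lemma sub_real_neq0 (z : C) (x : R) : 0 < complex.Im z -> x%:C - z != 0.
Proof.
case: z => a b /= b0; rewrite eq_complex /= negb_and; apply/orP; right.
by rewrite sub0r oppr_eq0 gt_eqF.
Qed.

Lemma conjc_subr (z : C) (x : R) : x%:C - conjc z = conjc (x%:C - z).
Proof. by case: z => a b; rewrite /=; simpc; rewrite /= ?opprK ?oppr0 ?sub0r ?opprK. Qed.

(** Splitting the phase evenly writes a Blaschke product as [P / conj P]. *)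
Definition psi_num (theta : R) (a : C * C) (x : R) : C :=
  cis (theta / 2) * (x%:C - a.1) * (x%:C - a.2).

Lemma psi_numE theta a x : upper_half a.1 -> upper_half a.2 ->
  psi theta a x * conjc (psi_num theta a x) = psi_num theta a x.
Proof.
move=> a1 a2; rewrite /psi /psi_num !conjc_subr cis_half.
have := sub_real_neq0 x a2; have := sub_real_neq0 x a1; have := cis_conj (theta / 2).
move: (@cis R _) (x%:C - a.1) (x%:C - a.2) => c u v cc u0 v0; rewrite !rmorphM /=.
by rewrite -[RHS]mulr1 -cc; field; rewrite !conjc_eq0 u0 v0.
Qed.

Lemma psi_unit (theta : R) (a : C * C) (x : R) : upper_half a.1 -> upper_half a.2 ->
  psi theta a x * conjc (psi theta a x) = 1.
Proof.
move=> a1 a2; rewrite /psi !conjc_subr.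
have := sub_real_neq0 x a2; have := sub_real_neq0 x a1; have := cis_conj theta.
move: (@cis R _) (x%:C - a.1) (x%:C - a.2) => c u v cc u0 v0.
rewrite !rmorphM !fmorphV /= !conjcK -cc.
by field; rewrite !conjc_eq0 u0 v0.
Qed.

End BlaschkeProducts.

(** * Distance to the Blaschke products *)

Section LowerBound.
Context {R : realType}.
Local Notation mu := (@lebesgue_measure R).
Local Notation mu2 := ((mu \x mu)%E).
Local Notation C := R[i].

Lemma psi_num_quadratic (theta : R) (a : C * C) : exists A1 A2 B1 B2 C1 C2 : R,
  A1 ^+ 2 + A2 ^+ 2 = 1 /\ forall x,
    complex.Re (psi_num theta a x) = A1 * x ^+ 2 + B1 * x + C1 /\
    complex.Im (psi_num theta a x) = A2 * x ^+ 2 + B2 * x + C2.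
Proof.
case: a => [[r1 i1] [r2 i2]]; rewrite /psi_num /cis.
have := cos2Dsin2 (theta / 2); move: (cos _) (sin _) => c s cs.
exists c, s, (s * (i1 + i2) - c * (r1 + r2)), (- c * (i1 + i2) - s * (r1 + r2)),
  (c * (r1 * r2 - i1 * i2) - s * (r1 * i2 + i1 * r2)),
  (s * (r1 * r2 - i1 * i2) + c * (r1 * i2 + i1 * r2)).
by split=> // x /=; split; ring.
Qed.

(** With [w = P x] and [z = P x / conj (P x)] these are the equations that
    [phase_match] needs. *)
Lemma Re_Im_mul_conj (z w : C) : z * conjc w = w ->
  complex.Re w = complex.Re z * complex.Re w + complex.Im z * complex.Im w /\
  complex.Im w = complex.Im z * complex.Re w - complex.Re z * complex.Im w.
Proof.
case: z w => s t [p q] /= => /eqP; rewrite eq_complex /= => /andP[/eqP h1 /eqP h2].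
by rewrite -{1}h1 -{3}h2; split; ring.
Qed.

Lemma Re_Im_unit (z : C) : z * conjc z = 1 ->
  complex.Re z ^+ 2 + complex.Im z ^+ 2 = 1.
Proof.
case: z => s t /eqP; rewrite eq_complex /= => /andP[/eqP h1 _].
by rewrite -[RHS]h1; ring.
Qed.

Let tri (x1 x2 x3 : R) (i : 'I_3) : R := nth 0 [:: x1; x2; x3] i.

(** Two unit-valued maps at small distance nearly agree on a sample of every
    scale at which the first looks like [X |-> (X - i) / (X + i)]. *)
Lemma sample_scale (u v : R -> C) (k l : R) : 0 < k -> k <= 1 -> 0 < l ->
    cmeasurable u -> cmeasurable v ->
    (forall x, complex.Re (u x) ^+ 2 + complex.Im (u x) ^+ 2 = 1) ->
    (forall x, complex.Re (v x) ^+ 2 + complex.Im (v x) ^+ 2 = 1) ->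
    (forall X, 1 <= X <= 6 ->
       `|complex.Re (u (l * X)) - (X ^+ 2 - 1) / (X ^+ 2 + 1)| <= k /\
       `|complex.Im (u (l * X)) - (- 2 * X) / (X ^+ 2 + 1)| <= k) ->
    (\int[mu2]_z (cabs ((u z.1 - v z.1) - (u z.2 - v z.2)) ^+ 2 /
       `|z.1 - z.2| ^+ 2)%:E < ((k / 5) ^+ 2)%:E)%E ->
  exists X : 'I_3 -> R,
    [/\ 1 <= X 0 <= 2, 3 <= X 1 <= 4, 5 <= X 2 <= 6 &
     forall i, `|complex.Re (v (l * X i)) - (X i ^+ 2 - 1) / (X i ^+ 2 + 1)| <= 100 * (400 * k) /\
       `|complex.Im (v (l * X i)) - (- 2 * X i) / (X i ^+ 2 + 1)| <= 100 * (400 * k)].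
Proof.
move=> k0 k1 l0 mu_ mv u1 v1 ub small.
have mF := measurable_diff_quot (cmeasurableB mu_ mv).
have c0 : 0 < (k / (5 * l)) ^+ 2 by rewrite exprn_gt0// divr_gt0// mulr_gt0.
have [||x1 [x2 [x3 [I1 I2 I3 F12 F13]]]] := exists_small_triple l0 c0 mF.
- by move=> z; rewrite divr_ge0 ?sqr_ge0.
- rewrite (_ : _ * _ = (k / 5) ^+ 2)//; field.
  by rewrite gt_eqF.
move: I1 I2 I3; rewrite !in_itv/= => /andP[p1 q1] /andP[p2 q2] /andP[p3 q3].
pose X1 := x1 / l; pose X2 := x2 / l; pose X3 := x3 / l.
have lX x : l * (x / l) = x by rewrite mulrC divfK// gt_eqF.
have J1 : 1 <= X1 <= 2 by rewrite /X1 ler_pdivlMr// ler_pdivrMr// mul1r p1.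
have J2 : 3 <= X2 <= 4 by rewrite /X2 ler_pdivlMr// ler_pdivrMr// p2.
have J3 : 5 <= X3 <= 6 by rewrite /X3 ler_pdivlMr// ler_pdivrMr// p3.
have W1 : 1 <= X1 <= 6.
  by clear -J1; move: J1 => /andP[? ?]; apply/andP; split; lra.
have W2 : 1 <= X2 <= 6.
  by clear -J2; move: J2 => /andP[? ?]; apply/andP; split; lra.
have W3 : 1 <= X3 <= 6.
  by clear -J3; move: J3 => /andP[? ?]; apply/andP; split; lra.
(* The nearly constant value of [u - v] on the sample is [a + ic]. *)
pose a := complex.Re (u x1 - v x1); pose c := complex.Im (u x1 - v x1).
have close x : x1 < x <= 6 * l ->
    cabs ((u x1 - v x1) - (u x - v x)) ^+ 2 / `|x1 - x| ^+ 2 < (k / (5 * l)) ^+ 2 ->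
    `|complex.Re (u x) - complex.Re (v x) - a| <= k /\
    `|complex.Im (u x) - complex.Im (v x) - c| <= k.
  move=> /andP[xx xl]; rewrite real_normK ?num_real//.
  have d0 : 0 < (x1 - x) ^+ 2 by rewrite exprn_even_gt0//= subr_eq0 lt_eqF.
  rewrite ltr_pdivrMr// cabs_sqr => H.
  have dl : (x1 - x) ^+ 2 <= (5 * l) ^+ 2.
    by clear -p1 xx xl l0; rewrite -sqrrN opprB; apply: lerXn2r; rewrite ?nnegrE; lra.
  have {}H : complex.Re ((u x1 - v x1) - (u x - v x)) ^+ 2 +
     complex.Im ((u x1 - v x1) - (u x - v x)) ^+ 2 <= k ^+ 2.
    apply: (le_trans (ltW H)).
    have -> : k ^+ 2 = (k / (5 * l)) ^+ 2 * (5 * l) ^+ 2 by field; rewrite gt_eqF.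
    by rewrite ler_pM2l.
  move: H; rewrite /a /c; case: (u x1) (v x1) (u x) (v x) => [r1 i1] [r2 i2] [r3 i3] [r4 i4] /=.
  have sq t s := @sqr_sum_norm_le R t s _ (ltW k0).
  move=> H; split; rewrite distrC.
    by apply: (sq _ ((i1 - i2) - (i3 - i4))).
  by apply: (sq _ ((r1 - r2) - (r3 - r4))); rewrite addrC.
have cl2 : `|complex.Re (u x2) - complex.Re (v x2) - a| <= k /\
    `|complex.Im (u x2) - complex.Im (v x2) - c| <= k.
  by apply: close F12; clear -p1 q1 p2 q2 l0 => /=; apply/andP; split; lra.
have cl3 : `|complex.Re (u x3) - complex.Re (v x3) - a| <= k /\
    `|complex.Im (u x3) - complex.Im (v x3) - c| <= k.
  by apply: close F13; clear -p1 q1 p3 q3 l0 => /=; apply/andP; split; lra.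
have cl1 : `|complex.Re (u x1) - complex.Re (v x1) - a| <= k /\
    `|complex.Im (u x1) - complex.Im (v x1) - c| <= k.
  rewrite /a /c; case: (u x1) (v x1) => [r1 i1] [r2 i2] /=.
  by rewrite !subrr normr0 ltW.
have sq1 := @sqr_sum1_norm_le1 R.
have a2 : `|a| <= 2.
  have := lerD (sq1 _ _ (u1 x1)) (sq1 _ _ (v1 x1)); rewrite /a.
  by case: (u x1) (v x1) => [r1 i1] [r2 i2] /=; exact: le_trans (ler_normB _ _).
have c2 : `|c| <= 2.
  have u1' := u1 x1; have v1' := v1 x1; rewrite addrC in u1'; rewrite addrC in v1'.
  have := lerD (sq1 _ _ u1') (sq1 _ _ v1'); rewrite /c.
  by case: (u x1) (v x1) => [r1 i1] [r2 i2] /=; exact: le_trans (ler_normB _ _).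
have quad x : 1 <= x / l <= 6 ->
    `|complex.Re (u x) - complex.Re (v x) - a| <= k /\
    `|complex.Im (u x) - complex.Im (v x) - c| <= k ->
    `|(a - (a ^+ 2 + c ^+ 2) / 2) * (x / l) ^+ 2 + (- 2 * c) * (x / l)
      + - (a + (a ^+ 2 + c ^+ 2) / 2)| <= 37 * 10 * k.
  move=> xl [h1 h2]; have [] := ub _ xl; rewrite lX => b1 b2.
  exact: unit_shift_quadratic xl (ltW k0) (u1 x) (v1 x) a2 c2 b1 b2 h1 h2.
have [m1 m2 m3] := quadratic_coef_le J1 J2 J3 (quad x1 W1 cl1) (quad x2 W2 cl2) (quad x3 W3 cl3).
have ak : `|a| <= 100 * (37 * 10 * k).
  by clear -m1 m3; move: m1 m3; rewrite !ler_norml => /andP[? ?] /andP[? ?];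
    apply/andP; split; lra.
have ck : `|c| <= 100 * (37 * 10 * k).
  by clear -m2; move: m2; rewrite !ler_norml => /andP[? ?]; apply/andP; split; lra.
have shift (s t b r : R) : `|r| <= 100 * (37 * 10 * k) -> `|s - b| <= k ->
    `|s - t - r| <= k -> `|t - b| <= 100 * (400 * k).
  clear -k0 => rk sb st.
  have -> : t - b = (s - b) - (s - t - r) - r by ring.
  apply: le_trans (ler_normB _ _) _; apply: le_trans (lerD (ler_normB _ _) (lexx _)) _.
  lra.
have fin x : 1 <= x / l <= 6 ->
    `|complex.Re (u x) - complex.Re (v x) - a| <= k /\
    `|complex.Im (u x) - complex.Im (v x) - c| <= k ->
    `|complex.Re (v x) - ((x / l) ^+ 2 - 1) / ((x / l) ^+ 2 + 1)| <= 100 * (400 * k) /\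
       `|complex.Im (v x) - (- 2 * (x / l)) / ((x / l) ^+ 2 + 1)| <= 100 * (400 * k).
  move=> xl [h1 h2]; have [] := ub _ xl; rewrite lX => b1 b2.
  by split; [exact: shift ak b1 h1|exact: shift ck b2 h2].
exists (tri X1 X2 X3); split => //.
move=> i; have [->|->|->] : [\/ i = 0, i = 1 | i = 2].
    case: i => -[|[|[|//]]] ?; [constructor 1|constructor 2|constructor 3]; exact: val_inj.
- by rewrite /tri/= lX; exact: fin.
- by rewrite /tri/= lX; exact: fin.
- by rewrite /tri/= lX; exact: fin.
Qed.

(** Here [P x = A x^2 + B x + C] is read at the scales [L] and [1/L], so the
    ratio of the scales is [h = L^-2]. *)
Lemma psi_not_two_scale (theta : R) (a : C * C) (L e : R) (X Y : 'I_3 -> R) :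
    upper_half a.1 -> upper_half a.2 -> 1 < L -> 0 <= e ->
    8 * (100 * (144 * e + 216 * L^-1)) < 1 ->
    1 <= X 0 <= 2 -> 3 <= X 1 <= 4 -> 5 <= X 2 <= 6 ->
    1 <= Y 0 <= 2 -> 3 <= Y 1 <= 4 -> 5 <= Y 2 <= 6 ->
    (forall i, `|complex.Re (psi theta a (L * X i)) - (X i ^+ 2 - 1) / (X i ^+ 2 + 1)| <= e /\
       `|complex.Im (psi theta a (L * X i)) - (- 2 * X i) / (X i ^+ 2 + 1)| <= e) ->
    (forall i, `|complex.Re (psi theta a (L^-1 * Y i)) - (Y i ^+ 2 - 1) / (Y i ^+ 2 + 1)| <= e /\
       `|complex.Im (psi theta a (L^-1 * Y i)) - (- 2 * Y i) / (Y i ^+ 2 + 1)| <= e) ->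
  False.
Proof.
move=> up1 up2 L1 e0 small x0 x1 x2 y0 y1 y2 HX HY.
have [A1 [A2 [B1 [B2 [C1 [C2 [A0 P]]]]]]] := psi_num_quadratic theta a.
have L0 : 0 < L by apply: lt_trans L1.
pose h := L ^- 2.
have hL : h <= L^-1 by rewrite /h lef_pV2 ?posrE ?exprn_gt0// expr2 ler_peMl// ltW.
have h0 : 0 < h by rewrite invr_gt0 exprn_gt0.
have h1 : h <= 1 by apply: le_trans hL _; rewrite invf_le1// ltW.
have pm x := Re_Im_mul_conj (@psi_numE R theta a x up1 up2).
have [Az Bz] : A1 * L ^+ 2 = 0 /\ A2 * L ^+ 2 = 0.
  have hr : 0 <= h <= 1 by rewrite h1 ltW.
  have sm : 8 * (100 * (144 * e + 216 * h)) < 1 by clear -small hL; lra.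
  apply: (@two_scale_rigidity _ _ _ (B1 * L) (B2 * L) (C1 * L ^+ 2) (C2 * L ^+ 2) h e
    X Y hr e0 sm x0 x1 x2 y0 y1 y2).
  - move=> i _ p q -> -> ->; have [b1 b2] := HX i; have [r1 r2] := pm (L * X i).
    have [E1 E2] := P (L * X i).
    have -> : A1 * L ^+ 2 * X i ^+ 2 + B1 * L * X i + h * (C1 * L ^+ 2) =
        complex.Re (psi_num theta a (L * X i)).
      by rewrite E1 /h; field; rewrite gt_eqF.
    have -> : A2 * L ^+ 2 * X i ^+ 2 + B2 * L * X i + h * (C2 * L ^+ 2) =
        complex.Im (psi_num theta a (L * X i)).
      by rewrite E2 /h; field; rewrite gt_eqF.
    exact: phase_match (sample_range i x0 x1 x2) e0 r1 r2 b1 b2.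
  - move=> i _ p q -> -> ->; have [b1 b2] := HY i; have [r1 r2] := pm (L^-1 * Y i).
    have [E1 E2] := P (L^-1 * Y i).
    have -> : h * (A1 * L ^+ 2) * Y i ^+ 2 + B1 * L * Y i + C1 * L ^+ 2 =
        L ^+ 2 * complex.Re (psi_num theta a (L^-1 * Y i)).
      by rewrite E1 /h; field; rewrite gt_eqF.
    have -> : h * (A2 * L ^+ 2) * Y i ^+ 2 + B2 * L * Y i + C2 * L ^+ 2 =
        L ^+ 2 * complex.Im (psi_num theta a (L^-1 * Y i)).
      by rewrite E2 /h; field; rewrite gt_eqF.
    have LL : 0 < L ^+ 2 by rewrite exprn_gt0.
    rewrite -(mulrA (L ^+ 2)) -mulrDr !(normrM (L ^+ 2)) (gtr0_norm LL) -mulrDr mulrCA ler_pM2l//.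
    exact: phase_match (sample_range i y0 y1 y2) e0 r1 r2 b1 b2.
have LL : L ^+ 2 != 0 by rewrite gt_eqF// exprn_gt0.
move: A0; move/eqP: Az; rewrite mulf_eq0 (negPf LL) orbF => /eqP ->.
move/eqP: Bz; rewrite mulf_eq0 (negPf LL) orbF => /eqP -> /eqP.
by rewrite !expr0n/= addr0 eq_sym oner_eq0.
Qed.

(** The tolerance [k] is chosen before [N], hence the bound does not depend on
    [N]; the scale [L] is then taken large depending on [N]. *)
Lemma distance_lower_bound : exists2 c : R, 0 < c & forall N, exists2 L : R, 1 < L &
  forall s theta (a : C * C), s = 1 \/ s = -1 -> upper_half a.1 -> upper_half a.2 ->
  (c%:E <= Hhalf_sqnorm (fun x => cis (uphase L s N.+1 x) - psi theta a x)%R)%E.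
Proof.
(* [D * k] collects the error [e = 100 * (400 * k)] of the samples and the ratio
   [1/L <= k]; it must stay below 1. *)
pose D : R := 8 * (100 * (144 * (100 * 400) + 216)).
have DE : D = 8 * (100 * (144 * (100 * 400) + 216)) by [].
have D1 : 1 <= D by rewrite DE; lra.
have D0 : 0 < D by exact: lt_le_trans D1.
clearbody D.
pose k : R := (2 * D)^-1.
have k0 : 0 < k by rewrite invr_gt0 mulr_gt0.
have Dk : D * k = 2^-1 by rewrite /k; field; rewrite gt_eqF.
have k1 : k <= 1.
  rewrite invf_le1 ?mulr_gt0//; clear -D1; lra.
have pi0 : 0 < 4 * pi ^+ 2 :> R by rewrite mulr_gt0// exprn_gt0// pi_gt0.
exists ((4 * pi ^+ 2)^-1 * (k / 5) ^+ 2).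
  by rewrite mulr_gt0 ?invr_gt0// exprn_gt0// divr_gt0.
move=> N; have [L [L1 kL] HL] := uphase_approx N k0.
have L0 : 0 < L by apply: lt_trans L1.
exists L => // s theta a ss a1 a2; rewrite leNgt; apply/negP => small.
pose u x : C := cis (uphase L s N.+1 x).
have mu_ : cmeasurable u by exact/cmeasurable_cis/continuous_uphase.
have mp := cmeasurable_psi theta a.
have u1 x : complex.Re (u x) ^+ 2 + complex.Im (u x) ^+ 2 = 1 by rewrite /= cos2Dsin2.
have p1 x := Re_Im_unit (@psi_unit R theta a x a1 a2).
have small' : (\int[mu2]_z (cabs ((u z.1 - psi theta a z.1) - (u z.2 - psi theta a z.2)) ^+ 2 /
       `|z.1 - z.2| ^+ 2)%:E < ((k / 5) ^+ 2)%:E)%E.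
  by move: small; rewrite /Hhalf_sqnorm EFinM lte_pmul2l// lte_fin invr_gt0.
have [|X [x0 x1 x2 HX]] := sample_scale k0 k1 L0 mu_ mp u1 p1 _ small'.
  by move=> X X16; apply: HL => //; left.
have Li0 : 0 < L^-1 by rewrite invr_gt0.
have [|Y [y0 y1 y2 HY]] := sample_scale k0 k1 Li0 mu_ mp u1 p1 _ small'.
  by move=> Y Y16; apply: HL => //; right.
apply: (psi_not_two_scale a1 a2 L1 _ _ x0 x1 x2 y0 y1 y2 HX HY).
  by clear -k0; lra.
have Lk : L^-1 <= k by rewrite -(ler_pM2r L0) mulVf ?gt_eqF.
apply: (@le_lt_trans _ _ (D * k)); last by rewrite Dk invf_lt1// ltr1n.
by clear -DE k0 Lk; rewrite DE; lra.
Qed.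

End LowerBound.

(** * Integrals of complex functions over a period *)

Section PeriodIntegral.
Context {R : realType}.
Local Notation mu := (@lebesgue_measure R).
Local Notation C := R[i].
Local Notation I := (`[0%R, (2 * pi)%R]%classic : set R).

Lemma twopi_gt0 : 0 < 2 * pi :> R.
Proof. by rewrite mulr_gt0// pi_gt0. Qed.

Lemma mu_period : mu I = (2 * pi)%:E.
Proof. by rewrite lebesgue_measure_itv/= lte_fin twopi_gt0 sube0. Qed.

(** Bounding components rather than moduli keeps all the estimates in [R]. *)
Definition cbound (z : C) (M : R) := `|complex.Re z| <= M /\ `|complex.Im z| <= M.

Definition bdd_measurable (f : R -> C) :=
  cmeasurable f /\ exists M, forall x, cbound (f x) M.

Lemma cbound_ge0 z M : cbound z M -> 0 <= M.
Proof. by move=> [/(le_trans (normr_ge0 _))]. Qed.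

Lemma cboundM z w M N : cbound z M -> cbound w N -> cbound (z * w) (2 * (M * N)).
Proof.
case: z w => a b [c d] [/= a1 b1] [/= c1 d1].
have H (s t m n : R) : `|s| <= m -> `|t| <= n -> `|s * t| <= m * n.
  by move=> ? ?; rewrite normrM ler_pM.
rewrite mulr2n mulrDl mul1r; split => /=.
  by apply: le_trans (ler_normB _ _) _; apply: lerD; exact: H.
by apply: le_trans (ler_normD _ _) _; apply: lerD; exact: H.
Qed.

Lemma cboundD z w M N : cbound z M -> cbound w N -> cbound (z + w) (M + N).
Proof.
case: z w => a b [c d] [/= a1 b1] [/= c1 d1].
by split => /=; apply: le_trans (ler_normD _ _) _; apply: lerD.
Qed.

Lemma cboundN z M : cbound z M -> cbound (- z) M.
Proof. by case: z => a b [/= a1 b1]; split; rewrite /= normrN. Qed.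

Lemma cbound_conj z M : cbound z M -> cbound (conjc z) M.
Proof. by case: z => a b [/= a1 b1]; split; rewrite /= ?normrN. Qed.

Lemma cbound_cis (t : R) : cbound (cis t) 1.
Proof. by split; [exact: cos_max|exact: sin_max]. Qed.

Lemma bdd_measurableM f g : bdd_measurable f -> bdd_measurable g ->
  bdd_measurable (fun x => f x * g x).
Proof.
move=> [mf [M Mf]] [mg [N Ng]]; split; first exact: cmeasurableM.
by exists (2 * (M * N)) => x; exact: cboundM.
Qed.

Lemma bdd_measurableB f g : bdd_measurable f -> bdd_measurable g ->
  bdd_measurable (fun x => f x - g x).
Proof.
move=> [mf [M Mf]] [mg [N Ng]]; split; first exact: cmeasurableB.
by exists (M + N) => x; apply: cboundD => //; exact: cboundN.
Qed.

Lemma bdd_measurable_cst (z : C) : bdd_measurable (fun=> z).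
Proof.
split; first exact: cmeasurable_cst.
by exists (Num.max `|complex.Re z| `|complex.Im z|) => x; split; rewrite le_max lexx ?orbT.
Qed.

Lemma bdd_measurableD f g : bdd_measurable f -> bdd_measurable g ->
  bdd_measurable (fun x => f x + g x).
Proof.
move=> bf bg; have := bdd_measurableB bf (bdd_measurableB (bdd_measurable_cst 0) bg).
by under eq_fun do rewrite sub0r opprK.
Qed.

Lemma bdd_measurable_conj f : bdd_measurable f -> bdd_measurable (fun x => conjc (f x)).
Proof.
move=> [[m1 m2] [M Mf]]; split; last by exists M => x; exact: cbound_conj.
split.
  by rewrite (_ : (fun _ => _) = (fun x => complex.Re (f x)))//; apply/funext => x; case: (f x).
rewrite (_ : (fun _ => _) = (fun x => - complex.Im (f x))); first exact: measurable_funN.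
by apply/funext => x; case: (f x).
Qed.

Lemma bdd_measurable_cis (g : R -> R) : continuous g -> bdd_measurable (fun x => cis (g x)).
Proof.
by move=> cg; split; [exact: cmeasurable_cis|exists 1 => x; exact: cbound_cis].
Qed.

Lemma integrable_period (f : R -> R) (M : R) : measurable_fun [set: R] f ->
  (forall x, `|f x| <= M) -> mu.-integrable I (EFin \o f).
Proof.
move=> mf Mf; apply: measurable_bounded_integrable => //.
- by apply: (le_lt_trans _ (ltry (2 * pi))); rewrite -mu_period.
- exact: measurable_funTS.
- exists M; split; first exact: num_real.
  by move=> y My x _; apply: le_trans (Mf x) (ltW My).
Qed.

Lemma integrable_Re f : bdd_measurable f ->
  mu.-integrable I (EFin \o (fun x => complex.Re (f x))).
Proof. by move=> [[m1 _] [M Mf]]; apply: (@integrable_period _ M m1) => x; case: (Mf x). Qed.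

Lemma integrable_Im f : bdd_measurable f ->
  mu.-integrable I (EFin \o (fun x => complex.Im (f x))).
Proof. by move=> [[_ m1] [M Mf]]; apply: (@integrable_period _ M m1) => x; case: (Mf x). Qed.

Local Notation cint := (cintegral I).

Lemma eq_cint f g : f =1 g -> cint f = cint g.
Proof. by move=> /funext ->. Qed.

Lemma cintD f g : bdd_measurable f -> bdd_measurable g ->
  cint (fun x => f x + g x) = cint f + cint g.
Proof.
move=> bf bg; rewrite /cintegral; apply/eqP; rewrite eq_complex /=; apply/andP; split; apply/eqP.
  rewrite -(RintegralD _ (integrable_Re bf) (integrable_Re bg))//.
  by apply: eq_Rintegral => x _; case: (f x) (g x) => a b [c d].
rewrite -(RintegralD _ (integrable_Im bf) (integrable_Im bg))//.
by apply: eq_Rintegral => x _; case: (f x) (g x) => a b [c d].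
Qed.

Lemma RintegralZ_bdd (f : R -> R) r : mu.-integrable I (EFin \o f) ->
  mu.-integrable I (EFin \o (fun x => r * f x)).
Proof.
by move=> fi; exact: (@integrableZl _ _ _ mu I (measurable_itv _) r _ fi).
Qed.

Lemma cintZ (z : C) f : bdd_measurable f -> cint (fun x => z * f x) = z * cint f.
Proof.
move=> bf; have [ir ii] := (integrable_Re bf, integrable_Im bf).
case: z => u v; rewrite /cintegral; apply/eqP; rewrite eq_complex /=; apply/andP; split; apply/eqP.
  rewrite -!RintegralZl// -RintegralB//; try exact: RintegralZ_bdd.
  by apply: eq_Rintegral => x _; case: (f x).
rewrite -!RintegralZl// -RintegralD//; try exact: RintegralZ_bdd.
by apply: eq_Rintegral => x _; case: (f x).
Qed.

Lemma cintB f g : bdd_measurable f -> bdd_measurable g ->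
  cint (fun x => f x - g x) = cint f - cint g.
Proof.
move=> bf bg; have bN : bdd_measurable (fun x => -1 * g x).
  exact: bdd_measurableM (bdd_measurable_cst _) bg.
rewrite -[- cint g]mulN1r -cintZ// -cintD//; apply: eq_cint => x.
by rewrite mulN1r.
Qed.

Lemma cbound_cint f M : bdd_measurable f -> (forall x, cbound (f x) M) ->
  cbound (cint f) (2 * pi * M).
Proof.
move=> bf Mf; have tp := twopi_gt0.
have H (g : R -> R) : mu.-integrable I (EFin \o g) -> (forall x, `|g x| <= M) ->
    `|Rintegral mu I g| <= 2 * pi * M.
  move=> ig gM; apply: le_trans (le_normr_Rintegral _ ig) _ => //.
  have -> : 2 * pi * M = \int[mu]_(x in I) M.
    rewrite [RHS]Rintegral_cst//= (_ : fine _ = 2 * pi); first by rewrite mulrC.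
    by have := congr1 fine mu_period.
  apply: le_Rintegral => //.
  - exact: integrable_norm ig.
  - by apply: (@integrable_period _ `|M|) => //; exact: measurable_cst.
by split; apply: H; [exact: integrable_Re|by move=> x; case: (Mf x)|
  exact: integrable_Im|by move=> x; case: (Mf x)].
Qed.

End PeriodIntegral.

(** * Fourier coefficients and Bessel's inequality *)

Section Fourier.
Context {R : realType}.
Local Notation mu := (@lebesgue_measure R).
Local Notation C := R[i].
Local Notation I := (`[0%R, (2 * pi)%R]%classic : set R).
Local Notation cint := (cintegral I).

Lemma cisD (s t : R) : cis (s + t) = cis s * cis t :> C.
Proof.
by rewrite /cis cosD sinD; simpc; congr (_ +i* _); rewrite addrC.
Qed.

Lemma cisN (t : R) : cis (- t) = conjc (cis t) :> C.
Proof. by rewrite /cis cosN sinN. Qed.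

Lemma cis0 : cis (0 : R) = 1 :> C.
Proof. by rewrite /cis cos0 sin0. Qed.

Lemma cisNr (t : R) : cis t * cis (- t) = 1 :> C.
Proof. by rewrite -cisD subrr cis0. Qed.

Lemma cabsM (z w : C) : cabs (z * w) ^+ 2 = cabs z ^+ 2 * cabs w ^+ 2.
Proof. by rewrite !cabs_sqr; case: z w => a b [c d] /=; ring. Qed.

Lemma cabs_cis (t : R) : cabs (cis t) ^+ 2 = 1.
Proof. by rewrite cabs_sqr /= cos2Dsin2. Qed.

Lemma derive_continuous (f df : R -> R) :
  (forall t : R, is_derive t 1 f (df t)) -> continuous f.
Proof.
move=> H t; apply: differentiable_continuous; apply/derivable1_diffP.
by have := H t => -[].
Qed.

Lemma Rintegral_FTC (F f : R -> R) (a b : R) : a < b ->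
    (forall t : R, is_derive t 1 F (f t)) -> continuous f ->
  \int[mu]_(t in `[a, b]) f t = F b - F a.
Proof.
move=> ab dF cf; have cF := derive_continuous dF.
rewrite /Rintegral (@continuous_FTC2 _ f F)//.
- exact: continuous_subspaceT.
- split.
  + by move=> t _; have := dF t => -[].
  + by apply: cvg_at_right_filter; exact: cF.
  + by apply: cvg_at_left_filter; exact: cF.
- by move=> t _; rewrite derive1E; have dFt := dF t; rewrite derive_val.
Qed.

(** The integrand is the derivative of [- i cis (F t)]. *)
Lemma cint_phase_derivative (F f : R -> R) :
    (forall t : R, is_derive t 1 F (f t)) -> continuous f ->
    cis (F (2 * pi)) = cis (F 0) :> C ->
  cint (fun t => (f t)%:C * cis (F t)) = 0.
Proof.
move=> dF cf /eqP; rewrite eq_complex /= => /andP[/eqP hc /eqP hs].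
have cF := derive_continuous dF; have tp := @twopi_gt0 R.
apply/eqP; rewrite /cintegral eq_complex /=; apply/andP; split; apply/eqP.
  transitivity (\int[mu]_(t in I) (f t * cos (F t))).
    by apply: eq_Rintegral => t _; rewrite mul0r subr0.
  have dS (t : R) : is_derive t 1 (fun t => sin (F t)) (f t * cos (F t)).
    have dFt := dF t; apply: is_derive_eq.
    by rewrite /GRing.scale /= mulrC.
  rewrite (Rintegral_FTC tp dS); first by rewrite hs subrr.
  move=> t; apply: cvgM; first exact: cf.
  by apply: continuous_cvg; [exact: continuous_cos|exact: cF].
transitivity (\int[mu]_(t in I) (f t * sin (F t))).
  by apply: eq_Rintegral => t _; rewrite mul0r addr0.
have dC (t : R) : is_derive t 1 (fun t => - cos (F t)) (f t * sin (F t)).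
  have dFt := dF t; apply: is_derive_eq.
  by rewrite /GRing.scale /=; ring.
rewrite (Rintegral_FTC tp dC); first by rewrite hc subrr.
move=> t; apply: cvgM; first exact: cf.
by apply: continuous_cvg; [exact: continuous_sin|exact: cF].
Qed.

Lemma cis_2pi_int (n : int) : cis (n%:~R * (2 * pi)) = 1 :> C.
Proof.
have P m : cis (m%:R * (2 * pi)) = 1 :> C.
  elim: m => [|m IH]; first by rewrite mul0r cis0.
  rewrite -natr1 mulrDl mul1r cisD IH mul1r.
  by rewrite /cis (_ : 2 * pi = pi *+ 2) ?cos2pi ?sin2pi// mulr_natl.
case: n => m; first exact: P.
by rewrite NegzE mulrNz mulNr cisN -pmulrn P conjc1.
Qed.

Definition expi (k : int) (t : R) : C := cis (k%:~R * t).

Lemma continuous_linear (k : int) : continuous (fun t : R => k%:~R * t).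
Proof. by move=> t; apply: cvgMl_tmp; exact: cvg_id. Qed.

Lemma bdd_expi k : bdd_measurable (expi k).
Proof. exact/bdd_measurable_cis/continuous_linear. Qed.

Lemma expiD j k t : expi (j + k) t = expi j t * expi k t.
Proof. by rewrite /expi intrD mulrDl cisD. Qed.

Lemma expiN k t : expi (- k) t = conjc (expi k t).
Proof. by rewrite /expi mulrNz mulNr cisN. Qed.

Lemma expi0 t : expi 0 t = 1.
Proof. by rewrite /expi mul0r cis0. Qed.

Lemma cint_expi k : cint (expi k) = if k == 0 then (2 * pi)%:C else 0.
Proof.
case: eqVneq => [->|k0].
  rewrite (@eq_cint _ _ (fun=> 1)); last exact: expi0.
  rewrite /cintegral /=; congr (_ +i* _).
    rewrite [LHS]Rintegral_cst//= mul1r.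
    by have := congr1 fine (@mu_period R).
  by rewrite [LHS]Rintegral_cst//= mul0r.
have kR : (k%:~R : R)%:C != 0 :> C.
  by rewrite eq_complex /= negb_and intr_eq0 k0.
apply: (mulfI kR); rewrite mulr0 -cintZ; last exact: bdd_expi.
apply: (@cint_phase_derivative (fun t => k%:~R * t) (fun=> k%:~R)).
- by move=> t; apply: is_derive_eq; rewrite /GRing.scale /= mulr1.
- by move=> t; exact: cvg_cst.
- by rewrite cis_2pi_int mulr0 cis0.
Qed.

Definition coef (f : R -> C) (k : int) : C :=
  ((2 * pi)^-1)%:C * cint (fun t => f t * expi (- k) t).

Lemma twopiV : ((2 * pi)^-1)%:C * (2 * pi : R)%:C = 1 :> C.
Proof. by rewrite -rmorphM /= mulVf ?rmorph1// gt_eqF// twopi_gt0. Qed.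

Lemma cint_coef f k : cint (fun t => f t * expi (- k) t) = (2 * pi)%:C * coef f k.
Proof. by rewrite /coef mulrA (mulrC (2 * pi)%:C) twopiV mul1r. Qed.

Lemma coefB f g k : bdd_measurable f -> bdd_measurable g ->
  coef (fun t => f t - g t) k = coef f k - coef g k.
Proof.
move=> bf bg; have be := bdd_expi (- k); rewrite /coef -mulrBr -cintB; try exact: bdd_measurableM.
by congr (_ * _); apply: eq_cint => t; rewrite mulrBl.
Qed.

Lemma coefZ z f k : bdd_measurable f -> coef (fun t => z * f t) k = z * coef f k.
Proof.
move=> bf; have bfe := bdd_measurableM bf (bdd_expi (- k)).
rewrite /coef mulrCA -(cintZ z bfe).
by congr (_ * _); apply: eq_cint => t; rewrite mulrA.
Qed.

Lemma coef_expi j k : coef (expi j) k = (j == k)%:R.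
Proof.
rewrite /coef (@eq_cint _ _ (expi (j - k))); last by move=> t; rewrite expiD.
by rewrite cint_expi subr_eq0; case: eqVneq => _; rewrite ?twopiV ?mulr0.
Qed.

Lemma coef_mul_expi f j k : coef (fun t => f t * expi j t) k = coef f (k - j).
Proof.
rewrite /coef; congr (_ * _); apply: eq_cint => t.
by rewrite -mulrA -expiD opprB.
Qed.

Lemma integrable_cabs2 f : bdd_measurable f ->
  mu.-integrable I (EFin \o (fun t => cabs (f t) ^+ 2)).
Proof.
move=> [[m1 m2] [M Mf]]; apply: (@integrable_period _ _ (M ^+ 2 + M ^+ 2)).
  under eq_fun do rewrite cabs_sqr.
  by apply: measurable_funD; apply: measurable_funX.
move=> x; rewrite ger0_norm ?sqr_ge0// cabs_sqr; have [h1 h2] := Mf x.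
have M0 := cbound_ge0 (Mf x).
rewrite -(real_normK (num_real (complex.Re _))) -(real_normK (num_real (complex.Im _))).
by apply: lerD; rewrite lerXn2r ?nnegrE.
Qed.

Definition energy2 (f : R -> C) : R := \int[mu]_(t in I) (cabs (f t) ^+ 2).

Lemma energy2_ge0 f : 0 <= energy2 f.
Proof. by apply: Rintegral_ge0 => t _; exact: sqr_ge0. Qed.

(** Pythagoras: [h - c_k e_k] is orthogonal to [e_k]. *)
Lemma energy2_remove_mode h k : bdd_measurable h ->
  energy2 (fun t => h t - coef h k * expi k t) = energy2 h - 2 * pi * cabs (coef h k) ^+ 2.
Proof.
move=> bh; set c := coef h k.
have bp : bdd_measurable (fun t => conjc c * (h t * expi (- k) t)).
  exact: bdd_measurableM (bdd_measurable_cst _) (bdd_measurableM bh (bdd_expi _)).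
have E t : cabs (h t - c * expi k t) ^+ 2 = cabs (h t) ^+ 2 -
    2 * complex.Re (conjc c * (h t * expi (- k) t)) + cabs c ^+ 2.
  have E0 (x e z : C) : cabs (x - z * e) ^+ 2 =
      cabs x ^+ 2 - 2 * complex.Re (conjc z * (x * conjc e)) + cabs (z * e) ^+ 2.
    by rewrite !cabs_sqr; case: x e z => a b [u v] [p q] /=; ring.
  by rewrite expiN E0 cabsM [cabs (expi k t) ^+ 2]cabs_cis mulr1.
rewrite /energy2; under eq_Rintegral do rewrite E.
have i1 := integrable_cabs2 bh; have i2 := RintegralZ_bdd 2 (integrable_Re bp).
have i3 : mu.-integrable I (EFin \o (fun=> cabs c ^+ 2)).
  by apply: (@integrable_period _ _ `|cabs c ^+ 2|) => //; exact: measurable_cst.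
rewrite RintegralD//; last first.
  exact: (@integrableB _ _ _ mu I (measurable_itv _) _ _ i1 i2).
rewrite RintegralB// RintegralZl//; last exact: integrable_Re.
have -> : \int[mu]_(t in I) complex.Re (conjc c * (h t * expi (- k) t)) =
    complex.Re (conjc c * ((2 * pi)%:C * c)).
  by have be := bdd_expi (- k); rewrite -cint_coef -cintZ//; exact: bdd_measurableM.
have -> : \int[mu]_(t in I) (cabs c ^+ 2) = 2 * pi * cabs c ^+ 2.
  rewrite [LHS]Rintegral_cst//= mulrC; congr (_ * _).
  by have := congr1 fine (@mu_period R).
by rewrite cabs_sqr; move: c {E bp i1 i2 i3} => [a b] /=; ring.
Qed.

(** Removing one mode at a time lowers the energy by its square. *)
Lemma bessel (s : seq int) h : uniq s -> bdd_measurable h ->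
  \sum_(k <- s) 2 * pi * cabs (coef h k) ^+ 2 <= energy2 h.
Proof.
elim: s h => [|k s IH] h; first by rewrite big_nil energy2_ge0.
move=> /= /andP[ks us] bh; rewrite big_cons -lerBrDl -energy2_remove_mode//.
have bk : bdd_measurable (fun t => coef h k * expi k t).
  exact: bdd_measurableM (bdd_measurable_cst _) (bdd_expi _).
apply: le_trans (IH _ us (bdd_measurableB bh bk)).
rewrite big_seq [leRHS]big_seq; apply: ler_sum => j js.
rewrite coefB// coefZ ?coef_expi; last exact: bdd_expi.
by rewrite (_ : k == j = false) ?mulr0 ?subr0//; apply/negP => /eqP kj; rewrite kj js in ks.
Qed.

End Fourier.

(** * The sum of [k |c_k|^2] for a map with a lift *)

Section Degree.
Context {R : realType}.
Local Notation mu := (@lebesgue_measure R).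
Local Notation C := R[i].
Local Notation I := (`[0%R, (2 * pi)%R]%classic : set R).
Local Notation cint := (cintegral I).

(** The frequencies from [-n] to [n - 1]. This window grows by one frequency at
    each end, as needed for telescoping by induction. *)
Definition modes (n : nat) : seq int := map Posz (iota 0 n) ++ map Negz (iota 0 n).

Lemma uniq_modes n : uniq (modes n).
Proof.
rewrite cat_uniq !map_inj_uniq ?iota_uniq//= ?andbT; try by move=> ? ? [].
by apply/hasPn => k /mapP[i _ ->]; apply/negP => /mapP[j _].
Qed.

Lemma big_modes (V : nmodType) (F : int -> V) n :
  \sum_(k <- modes n) F k = \sum_(m < n) F (Posz m) + \sum_(m < n) F (Negz m).
Proof.
have iE : iota 0 n = index_iota 0 n by rewrite /index_iota subn0.
by rewrite big_cat !big_map iE !big_mkord.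
Qed.

Lemma big_modesS (V : nmodType) (F : int -> V) n :
  \sum_(k <- modes n.+1) F k = \sum_(k <- modes n) F k + (F (Posz n) + F (Negz n)).
Proof. by rewrite !big_modes !big_ord_recr /= addrACA. Qed.

Lemma telescope_modes (V : zmodType) (G : int -> V) n :
  \sum_(k <- modes n) (G k - G (k + 1)) = G (- Posz n) - G (Posz n).
Proof.
elim: n => [|n IH]; first by rewrite big_nil oppr0 subrr.
rewrite big_modesS IH.
have -> : Posz n + 1 = Posz n.+1 by rewrite -PoszD addn1.
have -> : Negz n + 1 = - Posz n by rewrite NegzE -addn1 PoszD opprD addrNK.
by rewrite NegzE addrA subrKA addrC subrKA.
Qed.

Lemma sum_modes_delta n : \sum_(k <- modes n.+1) ((0 : int) == k)%:R = 1 :> C.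
Proof.
by rewrite big_modes big_ord_recl /= !big1 ?addr0.
Qed.


Lemma bdd_measurable_sum (s : seq int) (F : int -> R -> C) :
  (forall k, bdd_measurable (F k)) -> bdd_measurable (fun t => \sum_(k <- s) F k t).
Proof.
move=> bF; elim: s => [|k s IH].
  by under eq_fun do rewrite big_nil; exact: bdd_measurable_cst.
by under eq_fun do rewrite big_cons; exact: bdd_measurableD.
Qed.

(** By Bessel's inequality the squares of the coefficients are summable. *)
Lemma coef_cvg0 (h : R -> C) (e : nat -> int) : injective e -> bdd_measurable h ->
  cabs (coef h (e n)) ^+ 2 @[n --> \oo] --> (0 : R).
Proof.
move=> ie bh; apply: cvg_series_cvg_0; apply: nondecreasing_is_cvgn.
  apply/nondecreasing_seqP => n; rewrite /series /= big_nat_recr//= lerDl.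
  exact: sqr_ge0.
exists (energy2 h / (2 * pi)) => _ [n _ <-].
rewrite ler_pdivlMr ?twopi_gt0// mulrC mulr_sumr /index_iota subn0.
have u : uniq (map e (iota 0 n)) by rewrite map_inj_uniq// iota_uniq.
by apply: le_trans (bessel u bh); rewrite big_map.
Qed.

Lemma cbound_coef (h : R -> C) k K : bdd_measurable h -> (forall t, cbound (h t) K) ->
  cbound (coef h k) (4 * K).
Proof.
move=> bh hK; have tp := @twopi_gt0 R.
have he t : cbound (h t * expi (- k) t) (2 * (K * 1)).
  by apply: cboundM => //; exact: cbound_cis.
have := cbound_cint (bdd_measurableM bh (bdd_expi (- k))) he.
have r : cbound ((2 * pi)^-1)%:C ((2 * pi)^-1 : R).
  have tpi : 0 < (2 * pi : R)^-1 by rewrite invr_gt0.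
  split => /=; first by rewrite (gtr0_norm tpi).
  by rewrite normr0; exact: ltW.
move=> /(cboundM r); rewrite /coef; congr (cbound _ _).
by rewrite mulKf ?gt_eqF//; ring.
Qed.

(** The difference quotient [h] of [w] at [t] has small high modes, and turns
    the partial sums at [t] into telescoping sums. *)
Lemma fourier_partial_sum (w h : R -> C) (t : R) n :
    bdd_measurable w -> bdd_measurable h ->
    (forall s, w s - w t = h s * (expi 1 s - expi 1 t)) ->
  \sum_(k <- modes n.+1) coef w k * expi k t =
  w t + (expi (- Posz n.+1) t * coef h (- Posz n.+1 - 1) -
         expi (Posz n.+1) t * coef h (Posz n.+1 - 1)).
Proof.
move=> bw bh wh.
have cE k : coef w k = w t * ((0 : int) == k)%:R + (coef h (k - 1) - expi 1 t * coef h k).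
  have be := bdd_expi (R := R); have bc := @bdd_measurable_cst R.
  rewrite -coef_expi -coefZ// -coef_mul_expi -coefZ//.
  rewrite -coefB; [|exact: bdd_measurableM|exact: bdd_measurableM].
  rewrite -(subrK (coef (fun s => w t * expi 0 s) k) (coef w k)) addrC; congr (_ + _).
  rewrite -coefB//; last exact: bdd_measurableM.
  congr (coef _ k); apply/funext => s.
  by rewrite expi0 mulr1 wh mulrBr (mulrC (expi 1 t)).
under eq_bigr => k _ do rewrite cE mulrDl.
rewrite big_split /=; congr (_ + _).
  transitivity (\sum_(k <- modes n.+1) w t * ((0 : int) == k)%:R).
    apply: eq_bigr => k _; rewrite -mulrA; congr (_ * _).
    by case: eqVneq => [<-|_]; rewrite ?expi0 ?mulr1 ?mul0r.
  by rewrite -mulr_sumr sum_modes_delta mulr1.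
rewrite -(telescope_modes (fun k => expi k t * coef h (k - 1))).
by apply: eq_bigr => k _; rewrite addrK expiD mulrBl mulrC; congr (_ - _); ring.
Qed.

(** [cis \o F] is a map of the circle with a continuously differentiable lift
    [F], and [F_chord] says that it is [K]-Lipschitz for the distance of [C]. The
    latter bounds the difference quotients, also across the period. *)
Section Lift.
Variables (F f : R -> R) (M K : R).
Hypothesis dF : forall t : R, is_derive t 1 F (f t).
Hypothesis cf : continuous f.
Hypothesis fM : forall t, `|f t| <= M.
Hypothesis F_chord : forall s t, 2 - 2 * cos (F s - F t) <= K ^+ 2 * (2 - 2 * cos (s - t)).
Hypothesis K0 : 0 <= K.

Let w (t : R) : C := cis (F t).
Let v (t : R) : C := (f t)%:C * w t.

Let cF : continuous F := derive_continuous dF.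

Let bw : bdd_measurable w.
Proof. exact: bdd_measurable_cis. Qed.

Let bf : bdd_measurable (fun t => (f t)%:C).
Proof.
split; first by split; [exact: continuous_measurable_fun|exact: measurable_cst].
exists M => t; split => //=; rewrite normr0; exact: le_trans (fM t).
Qed.

Let bv : bdd_measurable v.
Proof. exact: bdd_measurableM. Qed.

(** Integration by parts: [(w e_(-k))' = i (f - k) w e_(-k)] has zero mean. *)
Lemma coef_derivative k : cis (F (2 * pi)) = cis (F 0) :> C ->
  coef v k = (k%:~R)%:C * coef w k.
Proof.
move=> per; rewrite /coef mulrCA; congr (_ * _).
have be := bdd_expi (R := R) (- k).
have bc := @bdd_measurable_cst R.
rewrite -cintZ; last exact: bdd_measurableM.
apply/eqP; rewrite -subr_eq0 -cintB; last 2 first.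
- exact: bdd_measurableM.
- by apply: bdd_measurableM => //; exact: bdd_measurableM.
apply/eqP; rewrite -[RHS](@cint_phase_derivative _ (fun t => F t + (- k)%:~R * t)
  (fun t => f t + (- k)%:~R)).
- apply: eq_cint => t; rewrite cisD -/(expi (- k) t) -/(w t) /v mulrNz.
  by rewrite rmorphB /=; ring.
- move=> t; have dFt := dF t; apply: is_derive_eq.
  by rewrite /GRing.scale /= mulr1.
- by move=> t; apply: cvgD; [exact: cf|exact: cvg_cst].
- by rewrite !cisD cis_2pi_int mulr0 cis0 per.
Qed.

(* At the points where the denominator vanishes so does the numerator, and the
   value 0 given by division is harmless. *)
Let quot (t s : R) : C := (w s - w t) / (expi 1 s - expi 1 t).

Let quotE t s : w s - w t = quot t s * (expi 1 s - expi 1 t).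
Proof.
have [e0|e0] := eqVneq (expi 1 s) (expi 1 t); last by rewrite divfK// subr_eq0.
rewrite e0 subrr mulr0; apply/eqP; have := F_chord s t.
have -> : 2 - 2 * cos (s - t) = 0.
  by rewrite -cabs_cisB; move: e0; rewrite /expi !mul1r => ->; rewrite subrr cabs_sqr /= expr0n addr0.
rewrite mulr0 -cabs_cisB cabs_sqr => H; rewrite -/(w s) -/(w t) in H.
have [r0 i0] : complex.Re (w s - w t) ^+ 2 = 0 /\ complex.Im (w s - w t) ^+ 2 = 0.
  by have := sqr_ge0 (complex.Re (w s - w t)); have := sqr_ge0 (complex.Im (w s - w t)); lra.
by rewrite eq_complex /= -(sqrf_eq0 (_ - _)) -(sqrf_eq0 (sin _ - _)); apply/andP; split; apply/eqP.
Qed.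

Let quot_cbound t s : cbound (quot t s) K.
Proof.
have H : cabs (quot t s) ^+ 2 <= K ^+ 2.
  have [e0|e0] := eqVneq (expi 1 s) (expi 1 t).
    by rewrite /quot e0 subrr invr0 mulr0 cabs_sqr /= !expr0n addr0 sqr_ge0.
  have d0 : 0 < cabs (expi 1 s - expi 1 t) ^+ 2.
    rewrite lt_neqAle sqr_ge0 andbT eq_sym; apply: contra e0.
    rewrite cabs_sqr paddr_eq0 ?sqr_ge0// !sqrf_eq0 /= => /andP[a b].
    by rewrite eq_complex /= -subr_eq0 a -subr_eq0 b.
  rewrite -(ler_pM2r d0) -cabsM -quotE /w cabs_cisB.
  by apply: le_trans (F_chord s t) _; rewrite /expi !mul1r cabs_cisB.
rewrite cabs_sqr in H; split; first exact: sqr_sum_norm_le K0 H.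
by apply: (@sqr_sum_norm_le _ _ (complex.Re (quot t s))) => //; rewrite addrC.
Qed.

Let bquot t : bdd_measurable (quot t).
Proof.
split; last by exists K.
have [b1 _] := bdd_measurableB bw (bdd_measurable_cst (w t)).
have [b2 _] := bdd_measurableB (bdd_expi 1) (bdd_measurable_cst (expi 1 t)).
exact: cmeasurableM (cmeasurableV b2).
Qed.

Let psum n t : C := \sum_(k <- modes n.+1) coef w k * expi k t.
Let rest n t : C := psum n t - w t.

Let restE n t : rest n t = expi (- Posz n.+1) t * coef (quot t) (- Posz n.+1 - 1) -
         expi (Posz n.+1) t * coef (quot t) (Posz n.+1 - 1).
Proof.
by rewrite /rest /psum (fourier_partial_sum _ bw (bquot t) (quotE t)) addrAC subrr add0r.
Qed.

Let rest_cbound n t : cbound (rest n t) (16 * K).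
Proof.
rewrite restE (_ : 16 * K = 2 * (1 * (4 * K)) + 2 * (1 * (4 * K))); last by ring.
apply: cboundD; last apply: cboundN; apply: cboundM;
  (exact: cbound_cis || exact: cbound_coef).
Qed.

Let cabs_rest n t : cabs (rest n t) ^+ 2 <=
  2 * (cabs (coef (quot t) (- Posz n.+1 - 1)) ^+ 2 + cabs (coef (quot t) (Posz n.+1 - 1)) ^+ 2).
Proof.
have E (x y : C) : cabs (x - y) ^+ 2 <= 2 * (cabs x ^+ 2 + cabs y ^+ 2).
  rewrite !cabs_sqr; case: x y => a b [c d] /=.
  by have := sqr_ge0 (a + c); have := sqr_ge0 (b + d); nra.
by rewrite restE; apply: le_trans (E _ _) _; rewrite !cabsM ![cabs (expi _ _) ^+ 2]cabs_cis !mul1r.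
Qed.

Let rest_cvg0 t : cabs (rest n t) ^+ 2 @[n --> \oo] --> (0 : R).
Proof.
have i1 : injective (fun n => - Posz n.+1 - 1).
  by move=> m n /addIr /oppr_inj [].
have i2 : injective (fun n => Posz n.+1 - 1).
  by move=> m n /addIr [].
have c1 := coef_cvg0 i1 (bquot t); have c2 := coef_cvg0 i2 (bquot t).
apply: (@squeeze_cvgr _ _ _ _ (fun=> 0)
  (fun n => 2 * (cabs (coef (quot t) (- Posz n.+1 - 1)) ^+ 2 + cabs (coef (quot t) (Posz n.+1 - 1)) ^+ 2))).
- by near=> n; rewrite sqr_ge0 cabs_rest.
- exact: cvg_cst.
- rewrite -[X in _ --> X](mulr0 2); apply: cvgMl_tmp.
  by have := cvgD c1 c2; rewrite addr0; apply.
Unshelve. all: by end_near. Qed.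

Let defect n t : R := complex.Re (v t * conjc (rest n t)).

Let brest n : bdd_measurable (rest n).
Proof.
apply: bdd_measurableB => //; apply: bdd_measurable_sum => k.
exact: bdd_measurableM (bdd_measurable_cst _) (bdd_expi _).
Qed.

(** Both sides are [Re (int v conj S)], where [S] is the partial sum of [w]: the
    left-hand side by [coef_derivative], the right-hand side by [S = w + rest]
    and [v conj w = f]. *)
Lemma weighted_modes n : cis (F (2 * pi)) = cis (F 0) :> C ->
  2 * pi * \sum_(k <- modes n.+1) k%:~R * cabs (coef w k) ^+ 2 =
  F (2 * pi) - F 0 + \int[mu]_(t in I) defect n t.
Proof.
move=> per.
have be := bdd_expi (R := R); have bc := @bdd_measurable_cst R.
have bp : bdd_measurable (psum n).
  by apply: bdd_measurable_sum => k; exact: bdd_measurableM.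
have bps := bdd_measurable_conj bp.
have -> : 2 * pi * \sum_(k <- modes n.+1) k%:~R * cabs (coef w k) ^+ 2 =
    complex.Re (cint (fun t => v t * conjc (psum n t))).
  rewrite (@eq_cint _ _ (fun t => \sum_(k <- modes n.+1) conjc (coef w k) * (v t * expi (- k) t))); last first.
    move=> t; rewrite /psum rmorph_sum mulr_sumr; apply: eq_bigr => k _.
    by rewrite rmorphM /= expiN mulrCA.
  have -> : forall s : seq int, cint (fun t => \sum_(k <- s) conjc (coef w k) * (v t * expi (- k) t)) =
      \sum_(k <- s) (2 * pi * (k%:~R * cabs (coef w k) ^+ 2))%:C.
    elim=> [|k s IH].
      rewrite big_nil (@eq_cint _ _ (fun t => 0 * w t)); last by move=> t; rewrite big_nil mul0r.
      by rewrite cintZ// mul0r.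
    rewrite big_cons -IH.
    rewrite (@eq_cint _ _ (fun t => conjc (coef w k) * (v t * expi (- k) t) +
      \sum_(j <- s) conjc (coef w j) * (v t * expi (- j) t))); last by move=> t; rewrite big_cons.
    have bk j : bdd_measurable (fun t => conjc (coef w j) * (v t * expi (- j) t)).
      exact: bdd_measurableM (bdd_measurableM _ _).
    rewrite cintD//; last exact: bdd_measurable_sum.
    congr (_ + _); rewrite cintZ; last exact: bdd_measurableM.
    rewrite cint_coef coef_derivative// cabs_sqr.
    by case: (coef w k) => a b; apply/eqP; rewrite eq_complex /=; apply/andP; split; apply/eqP; ring.
  by rewrite -rmorph_sum /= mulr_sumr.
have E t : complex.Re (v t * conjc (psum n t)) = f t + defect n t.
  have -> : psum n t = w t + rest n t by rewrite /rest addrC subrK.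
  have -> : v t * conjc (w t + rest n t) = (f t)%:C + v t * conjc (rest n t).
    rewrite rmorphD mulrDr; congr (_ + _).
    by rewrite /v -mulrA [X in _ * X](_ : _ = 1) ?mulr1//; exact: cis_conj.
  by rewrite /defect; case: (v t * _).
rewrite /cintegral /=; under eq_Rintegral do rewrite E.
rewrite RintegralD//; last 2 first.
- exact: integrable_Re bf.
- exact: integrable_Re (bdd_measurableM bv (bdd_measurable_conj (brest n))).
by rewrite (Rintegral_FTC (@twopi_gt0 R) dF cf).
Qed.

Let defect_cvg0 : (\int[mu]_(t in I) defect n t) @[n --> \oo] --> (0 : R).
Proof.
have M0 : 0 <= M := le_trans (normr_ge0 _) (fM 0).
have vM t : cbound (v t) (2 * (M * 1)).
  apply: cboundM; last exact: cbound_cis.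
  by split => //=; rewrite normr0.
pose B := 2 * (2 * (M * 1) * (16 * K)).
have dB n t : `|defect n t| <= B.
  by have [] := cboundM (vM t) (cbound_conj (rest_cbound n t)).
have bd n : bdd_measurable (fun t => v t * conjc (rest n t)).
  exact: bdd_measurableM bv (bdd_measurable_conj (brest n)).
have dcv t : defect n t @[n --> \oo] --> (0 : R).
  apply/cvgr0Pnorm_lt => e e0.
  have e2 : 0 < (e / (4 * (M + 1))) ^+ 2 by rewrite exprn_gt0// divr_gt0// mulr_gt0// ltr_wpDl.
  have /cvgr0Pnorm_lt /(_ _ e2) := rest_cvg0 t.
  apply: filterS => n; rewrite ger0_norm ?sqr_ge0// cabs_sqr => H.
  have e3 : 0 <= e / (4 * (M + 1)) by rewrite divr_ge0// ?ltW// mulr_gt0// ltr_wpDl.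
  have cr : cbound (rest n t) (e / (4 * (M + 1))).
    split; first exact: sqr_sum_norm_le e3 (ltW H).
    by apply: (@sqr_sum_norm_le _ _ (complex.Re (rest n t))) => //; rewrite addrC ltW.
  have [h _] := cboundM (vM t) (cbound_conj cr).
  apply: le_lt_trans h _.
  have M1 : M + 1 != 0 by rewrite gt_eqF// ltr_wpDl.
  have -> : 2 * (2 * (M * 1) * (e / (4 * (M + 1)))) = e * (M / (M + 1)) by field.
  by rewrite gtr_pMr// ltr_pdivrMr ?mul1r ?ltrDl// ltr_wpDl.
have : (\int[mu]_(t in I) (defect n t)%:E)%E @[n --> \oo] --> (\int[mu]_(t in I) (cst 0%E t))%E.
  apply: (@dominated_cvg _ _ _ mu I _ (fun n t => (defect n t)%:E) (cst 0%E) (cst B%:E)) => //.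
  - move=> n; apply/measurable_EFinP; apply: measurable_funTS.
    by have [[]] := bd n.
  - by move=> t _; apply/(@fine_cvgP _ _ _ _ _ 0); split; [exact: nearW|exact: dcv].
  - apply: (@integrable_period _ (cst B) `|B|) => //; exact: measurable_cst.
  - by move=> n t _; rewrite lee_fin.
by rewrite integral0 => H; exact: (fine_cvg H).
Qed.

(** The rest tends to zero pointwise and boundedly. *)
Lemma weighted_modes_cvg : cis (F (2 * pi)) = cis (F 0) :> C ->
  \sum_(k <- modes n.+1) k%:~R * cabs (coef w k) ^+ 2 @[n --> \oo] -->
  (F (2 * pi) - F 0) / (2 * pi).
Proof.
move=> per; have tp := @twopi_gt0 R.
have -> : (fun n => \sum_(k <- modes n.+1) k%:~R * cabs (coef w k) ^+ 2) =
    (fun n => (F (2 * pi) - F 0 + \int[mu]_(t in I) defect n t) / (2 * pi)).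
  by apply/funext => n; rewrite -weighted_modes// mulrAC divff ?gt_eqF// mul1r.
apply: cvgMr_tmp; rewrite -[X in _ --> X]addr0.
by apply: cvgD; [exact: cvg_cst|exact: defect_cvg0].
Qed.

(** [|k| |c_k|^2 <= |k c_k|^2], and [k c_k] are the coefficients of [v]. *)
Lemma square_modes_bound n : cis (F (2 * pi)) = cis (F 0) :> C ->
  \sum_(k <- modes n) `|k%:~R * cabs (coef w k) ^+ 2| <= energy2 v / (2 * pi).
Proof.
move=> per; rewrite ler_pdivlMr ?twopi_gt0// mulrC mulr_sumr.
apply: le_trans (bessel (uniq_modes n) bv); apply: ler_sum => k _.
rewrite ler_pM2l ?twopi_gt0// coef_derivative// cabsM normrM (ger0_norm (sqr_ge0 (cabs _))).
apply: ler_wpM2r; first exact: sqr_ge0.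
rewrite cabs_sqr /= expr0n addr0 -real_normK ?num_real// expr2.
case: (eqVneq k 0) => [->|k0]; first by rewrite normr0 mulr0.
by rewrite ler_peMl// -intr_norm ler1z -gtz0_ge1 normr_gt0.
Qed.

End Lift.

End Degree.

(** * Sums over the integers *)

Section IntSum.
Context {R : realType}.

Lemma esum_int_modes (a : int -> R) (l : R) : (forall k, 0 <= a k) ->
    \sum_(k <- modes n) a k @[n --> \oo] --> l ->
  (\esum_(k in [set: int]) (a k)%:E = l%:E)%E.
Proof.
move=> a0 al.
have a0' k : (0 <= (a k)%:E)%E by rewrite lee_fin.
rewrite (esumID (range Posz))//.
have -> : [set: int] `&` range Posz = [set Posz x | x in [set: nat]] by rewrite setTI.
have -> : [set: int] `&` ~` range Posz = [set Negz x | x in [set: nat]].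
  rewrite setTI; apply/seteqP; split => [[n|n] /=|_ [n _ <-] [m _]]//.
    by move=> H; exfalso; apply: H; exists n.
  by move=> _; exists n.
rewrite !esum_image; try by move=> m n _ _ [].
rewrite -!nneseries_esumT//.
have cP := @is_cvg_nneseries R (fun n => (a (Posz n))%:E) xpredT 0 (fun n _ _ => a0' _).
have cN := @is_cvg_nneseries R (fun n => (a (Negz n))%:E) xpredT 0 (fun n _ _ => a0' _).
have al' : (\sum_(k <- modes n) a k)%:E @[n --> \oo] --> l%:E.
  by apply/fine_cvgP; split => //; exact: nearW.
rewrite -(cvg_lim (@ereal_hausdorff R) al'); apply/esym.
have -> : (fun n => (\sum_(k <- modes n) a k)%:E) =
  (fun n => \sum_(0 <= i < n) (a (Posz i))%:E + \sum_(0 <= i < n) (a (Negz i))%:E)%E.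
  apply/funext => n; rewrite big_modes EFinD !big_mkord.
  by rewrite -!sumEFin.
apply: cvg_lim => //; apply: cvgeD => //.
by rewrite ge0_adde_def// inE; apply: nneseries_ge0.
Qed.

Lemma int_sum_modes (a : int -> R) (l B : R) :
    (forall n, \sum_(k <- modes n) `|a k| <= B) ->
    \sum_(k <- modes n) a k @[n --> \oo] --> l ->
  int_sum a = l%:E.
Proof.
move=> aB al.
have part (b : int -> R) : (forall k, 0 <= b k <= `|a k|) ->
    cvgn (fun n => \sum_(k <- modes n) b k).
  move=> b0; apply: nondecreasing_is_cvgn.
    apply/nondecreasing_seqP => n; rewrite big_modesS lerDl.
    by apply: addr_ge0; [case/andP: (b0 (Posz n))|case/andP: (b0 (Negz n))].
  exists B => _ [n _ <-]; apply: le_trans (aB n); apply: ler_sum => k _.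
  by case/andP: (b0 k).
have pb k : 0 <= Num.max (a k) 0 <= `|a k|.
  by rewrite le_max lexx orbT ge_max ler_norm normr_ge0.
have nb k : 0 <= Num.max (- a k) 0 <= `|a k|.
  by rewrite le_max lexx orbT ge_max -normrN ler_norm normr_ge0.
have cp := part _ pb; have cn := part _ nb.
rewrite /int_sum (esum_int_modes _ cp); last by move=> k; case/andP: (pb k).
rewrite (esum_int_modes _ cn); last by move=> k; case/andP: (nb k).
rewrite -EFinB; congr (_%:E).
rewrite -(cvg_lim (@Rhausdorff R) al); apply/esym; apply: cvg_lim => //.
rewrite (_ : (fun n => \sum_(k <- modes n) a k) = (fun n =>
   \sum_(k <- modes n) Num.max (a k) 0 - \sum_(k <- modes n) Num.max (- a k) 0)).
  exact: cvgB.
apply/funext => n; rewrite -sumrB; apply: eq_bigr => k _.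
have [h|/ltW h] := leP 0 (a k).
  have hN : - a k <= 0 by rewrite oppr_le0.
  by rewrite (max_r hN) subr0.
have hN : 0 <= - a k by rewrite oppr_ge0.
by rewrite (max_l hN) sub0r opprK.
Qed.

End IntSum.

(** * Smooth functions on the circle *)

Section Periodic.
Context {R : realType}.
Implicit Types g h : R -> R.

Local Notation chord x := (2 - 2 * cos x).

Lemma chord_ge0 (x : R) : 0 <= chord x.
Proof. by rewrite subr_ge0 -[leRHS]mulr1 ler_pM2l// cos_le1. Qed.

(** The parallelogram inequality for [cis (x + y) - 1]. *)
Lemma chordD (x y : R) : chord (x + y) <= 2 * chord x + 2 * chord y.
Proof.
rewrite cosD; have := cos2Dsin2 x; have := cos2Dsin2 y.
have := sqr_ge0 (sin x - sin y); have := sqr_ge0 (1 - cos x); have := sqr_ge0 (1 - cos y).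
have := sqr_ge0 (cos x + cos y - 2); nra.
Qed.

Lemma chordE (s t : R) : chord (s - t) = (cos s - cos t) ^+ 2 + (sin s - sin t) ^+ 2.
Proof. by rewrite -cabs_cisB cabs_sqr. Qed.

(** Functions on the circle, as periodic functions: continuously differentiable
    and Lipschitz for the chordal distance. *)
Definition circle_smooth g := exists g' M K, [/\ 0 <= M, 0 <= K,
  (forall t : R, is_derive t 1 g (g' t)) /\ continuous g',
  (forall t, `|g t| <= M /\ `|g' t| <= M) &
  g (2 * pi) = g 0 /\ forall s t, (g s - g t) ^+ 2 <= K * chord (s - t)].

Lemma circle_smooth_cst (c : R) : circle_smooth (fun=> c).
Proof.
exists (fun=> 0), `|c|, 0; split => //.
- by split => [t|t]; [exact: is_derive_cst|exact: cvg_cst].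
- by move=> t; rewrite normr0.
- by split=> // s t; rewrite subrr expr0n mul0r.
Qed.

Lemma circle_smooth_sin : circle_smooth sin.
Proof.
exists cos, 1, 1; split => //.
- by split => [t|]; [exact: is_derive_sin|exact: continuous_cos].
- by move=> t; rewrite sin_max cos_max.
- split; first by rewrite mulr_natl sin2pi sin0.
  by move=> s t; rewrite mul1r chordE lerDr sqr_ge0.
Qed.

Lemma circle_smooth_cos : circle_smooth cos.
Proof.
exists (fun t => - sin t), 1, 1; split => //.
- split => [t|t]; first by have := is_derive_cos t.
  by apply: cvgN; exact: continuous_sin.
- by move=> t; rewrite normrN sin_max cos_max.
- split; first by rewrite mulr_natl cos2pi cos0.
  by move=> s t; rewrite mul1r chordE lerDl sqr_ge0.
Qed.

Lemma circle_smoothD g h : circle_smooth g -> circle_smooth h ->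
  circle_smooth (fun t => g t + h t).
Proof.
move=> [g' [M [K [M0 K0 [dg cg] bg [pg lg]]]]] [h' [N [J [N0 J0 [dh ch] bh [ph lh]]]]].
exists (fun t => g' t + h' t), (M + N), (2 * K + 2 * J); split.
- exact: addr_ge0.
- by rewrite addr_ge0// mulr_ge0.
- split => [t|t]; last by apply: cvgD; [exact: cg|exact: ch].
  by have [? ?] := (dg t, dh t); apply: is_derive_eq.
- move=> t; have [b1 b2] := bg t; have [b3 b4] := bh t.
  by split; apply: le_trans (ler_normD _ _) _; apply: lerD.
- split; first by rewrite pg ph.
  move=> s t; have := lg s t; have := lh s t.
  have := sqr_ge0 ((g s - g t) - (h s - h t)); nra.
Qed.

Lemma circle_smoothM g h : circle_smooth g -> circle_smooth h ->
  circle_smooth (fun t => g t * h t).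
Proof.
move=> [g' [M [K [M0 K0 [dg cg] bg [pg lg]]]]] [h' [N [J [N0 J0 [dh ch] bh [ph lh]]]]].
have [cg0 ch0] := (derive_continuous dg, derive_continuous dh).
have nM (a b m n : R) : `|a| <= m -> `|b| <= n -> `|a * b| <= m * n.
  by move=> ? ?; rewrite normrM ler_pM.
exists (fun t => g t * h' t + h t * g' t), (2 * (M * N)),
  (2 * (M ^+ 2 * J) + 2 * (N ^+ 2 * K)); split.
- by rewrite !mulr_ge0.
- by rewrite addr_ge0// !mulr_ge0// sqr_ge0.
- split => [t|t].
    by have [? ?] := (dg t, dh t); apply: is_derive_eq.
  by apply: cvgD; apply: cvgM; [exact: cg0|exact: ch|exact: ch0|exact: cg].
- move=> t; have [b1 b2] := bg t; have [b3 b4] := bh t.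
  have e1 := nM _ _ _ _ b1 b3; have e2 := nM _ _ _ _ b1 b4; have e3 := nM _ _ _ _ b3 b2.
  have MN : 0 <= M * N by rewrite mulr_ge0.
  split; first by lra.
  by apply: le_trans (ler_normD _ _) _; rewrite (mulrC N M) in e3; lra.
- split; first by rewrite pg ph.
  move=> s t; have [b1 _] := bg s; have [b3 _] := bh t.
  have sq (x m : R) : `|x| <= m -> x ^+ 2 <= m ^+ 2.
    by move=> xm; rewrite -(real_normK (num_real x)) lerXn2r ?nnegrE//; apply: le_trans xm.
  have e1 : (g s * (h s - h t)) ^+ 2 <= M ^+ 2 * J * chord (s - t).
    by rewrite exprMn -mulrA; apply: ler_pM; rewrite ?sqr_ge0// sq.
  have e2 : (h t * (g s - g t)) ^+ 2 <= N ^+ 2 * K * chord (s - t).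
    by rewrite exprMn -mulrA; apply: ler_pM; rewrite ?sqr_ge0// sq.
  have -> : g s * h s - g t * h t = g s * (h s - h t) + h t * (g s - g t) by ring.
  have := sqr_ge0 (g s * (h s - h t) - h t * (g s - g t)).
  move: e1 e2; set x := g s * _; set y := h t * _; set c := chord _; nra.
Qed.

Lemma circle_smoothV g (b : R) : 0 < b -> (forall t, b <= g t) -> circle_smooth g ->
  circle_smooth (fun t => (g t)^-1).
Proof.
move=> b0 gb [g' [M [K [M0 K0 [dg cg] bg [pg lg]]]]].
have c2 : continuous (fun t => g t * g t).
  have cg0 := derive_continuous dg.
  by move=> t; apply: cvgM; exact: cg0.
have g0 t : 0 < g t := lt_le_trans b0 (gb t).
have bV : 0 <= b^-1 by rewrite invr_ge0 ltW.
have b2V : 0 <= b ^- 2 by rewrite invr_ge0 exprn_ge0// ltW.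
have gV t : `|(g t)^-1| <= b^-1.
  by rewrite gtr0_norm ?invr_gt0// lef_pV2 ?posrE.
exists (fun t => - (g t) ^- 2 * g' t), (b^-1 + b ^- 2 * M), (b ^- 2 * b ^- 2 * K); split.
- by rewrite addr_ge0// mulr_ge0.
- by rewrite !mulr_ge0.
- split => [t|t].
    have gn : g t != 0 by rewrite gt_eqF.
    exact: (is_deriveV gn (dg t)).
  apply: cvgM; last exact: cg; apply: cvgN; apply: cvgV.
    by rewrite expf_neq0// gt_eqF.
  exact: c2.
- move=> t; have [b1 b2] := bg t; split.
    by apply: le_trans (gV t) _; rewrite lerDl mulr_ge0.
  rewrite normrM normrN -[leLHS]add0r; apply: lerD => //.
  apply: ler_pM => //; rewrite -!exprVn normrX.
  by rewrite lerXn2r ?nnegrE.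
- split; first by rewrite pg.
  move=> s t.
  have -> : (g s)^-1 - (g t)^-1 = - ((g s)^-1 * (g t)^-1 * (g s - g t)).
    by field; rewrite !gt_eqF.
  rewrite sqrrN exprMn -[leRHS]mulrA; apply: ler_pM; rewrite ?sqr_ge0//.
  rewrite exprMn; apply: ler_pM; rewrite ?sqr_ge0//.
    by rewrite -(real_normK (num_real _)) -exprVn lerXn2r ?nnegrE.
  by rewrite -(real_normK (num_real _)) -exprVn lerXn2r ?nnegrE.
Qed.

Lemma circle_smooth_atan g : circle_smooth g -> circle_smooth (fun t => atan (g t)).
Proof.
move=> [g' [M [K [M0 K0 [dg cg] bg [pg lg]]]]].
have c2 : continuous (fun t => g t * g t).
  have cg0 := derive_continuous dg.
  by move=> t; apply: cvgM; exact: cg0.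
have p0 x : 0 < 1 + x ^+ 2 :> R by rewrite ltr_pwDl// sqr_ge0.
exists (fun t => g' t * (1 + (g t) ^+ 2)^-1), M, K; split => //.
- split => [t|t].
    rewrite mulrC.
    exact: (@is_derive1_comp R atan g t _ _ (is_derive1_atan (g t)) (dg t)).
  apply: cvgM; first exact: cg; apply: cvgV; first by rewrite gt_eqF.
  apply: cvgD; first exact: cvg_cst.
  exact: c2.
- move=> t; have [b1 b2] := bg t; split.
    have := atan_lipschitz (g t) 0; rewrite atan0 !subr0 => H; exact: le_trans b1.
  rewrite normrM; apply: le_trans b2; apply: ler_piMr => //.
  by rewrite gtr0_norm ?invr_gt0// invf_le1// lerDl sqr_ge0.
- split; first by rewrite pg.
  move=> s t; apply: le_trans (lg s t).
  rewrite -(real_normK (num_real (atan _ - _))) -(real_normK (num_real (g s - g t))).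
  by rewrite lerXn2r ?nnegrE// atan_lipschitz.
Qed.

Lemma circle_smooth_sum n (G : 'I_n -> R -> R) : (forall j, circle_smooth (G j)) ->
  circle_smooth (fun t => \sum_(j < n) G j t).
Proof.
move=> H; elim: n G H => [|n IH] G H.
  by under eq_fun do rewrite big_ord0; exact: circle_smooth_cst.
by under eq_fun do rewrite big_ord_recl; apply: circle_smoothD => //; exact: IH.
Qed.

End Periodic.

(** * The candidate map on the circle *)

Section CircleLift.
Context {R : realType}.
Local Notation mu := (@lebesgue_measure R).
Local Notation C := R[i].
Local Notation I := (`[0%R, (2 * pi)%R]%classic : set R).

Lemma sin_gtN1 (t r : R) : `|r| < 1 -> 1 - `|r| <= 1 + r * sin t.
Proof.
move=> r1; rewrite lerD2l -[leRHS]opprK lerN2 -mulNr.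
apply: le_trans (ler_norm _) _; rewrite normrM normrN.
by rewrite -[leRHS]mulr1; apply: ler_wpM2l => //; exact: sin_max.
Qed.

(** The argument of [1 + i r exp (- i t)] for [r = (1 - l) / (1 + l)], a point of
    the open right half-plane. *)
Definition mobius_arg (l t : R) : R :=
  atan ((1 - l) / (1 + l) * cos t * (1 + (1 - l) / (1 + l) * sin t)^-1).

Lemma mobius_coef_lt1 (l : R) : 0 < l -> `|(1 - l) / (1 + l)| < 1.
Proof.
move=> l0; have l1 : 0 < 1 + l by rewrite ltr_wpDl.
by rewrite ltr_norml ltr_pdivrMr// ltr_pdivlMr//; apply/andP; split; lra.
Qed.

Lemma circle_smooth_mobius_arg (l : R) : 0 < l -> circle_smooth (mobius_arg l).
Proof.
move=> /mobius_coef_lt1; rewrite /mobius_arg; move: (_ / _) => r r1.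
apply: circle_smooth_atan; apply: circle_smoothM.
  by apply: circle_smoothM; [exact: circle_smooth_cst|exact: circle_smooth_cos].
apply: (@circle_smoothV _ _ (1 - `|r|)); first by rewrite subr_gt0.
  by move=> t; exact: sin_gtN1.
apply: circle_smoothD; first exact: circle_smooth_cst.
by apply: circle_smoothM; [exact: circle_smooth_cst|exact: circle_smooth_sin].
Qed.

Lemma mobius_arg_identity (l c s : R) (r := (1 - l) / (1 + l))
    (y := c / (1 - s) / l) (p := r * c * (1 + r * s)^-1) :
    0 < l -> -1 <= s -> s < 1 -> 0 < 1 + r * s -> c * c = (1 - s) * (1 + s) ->
  (1 - y ^+ 2) / (1 + y ^+ 2) =
    - (s * ((1 - p ^+ 2) / (1 + p ^+ 2)) + c * (2 * p / (1 + p ^+ 2))) /\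
  2 * y / (1 + y ^+ 2) =
    c * ((1 - p ^+ 2) / (1 + p ^+ 2)) - s * (2 * p / (1 + p ^+ 2)).
Proof.
move=> l0 s1 s1' q0 c2.
have D0 : 0 < (1 + s) + l ^+ 2 * (1 - s).
  by rewrite ltr_wpDl ?mulr_gt0 ?exprn_gt0 ?subr_gt0//; lra.
have l1 : 1 + l != 0 by rewrite gt_eqF// ltr_wpDl.
have s0 : 1 - s != 0 by rewrite subr_eq0 gt_eqF.
have ln0 : l != 0 by rewrite gt_eqF.
have qn0 : 1 + r * s != 0 by rewrite gt_eqF.
have Dn0 : (1 + s) + l ^+ 2 * (1 - s) != 0 by rewrite gt_eqF.
have y2 : y ^+ 2 = (1 + s) / ((1 - s) * l ^+ 2).
  transitivity (c * c / ((1 - s) ^+ 2 * l ^+ 2)); last rewrite c2;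
    by rewrite /y; field; rewrite s0 ln0.
have Qn0 : (1 + l) + (1 - l) * s != 0.
  have -> : (1 + l) + (1 - l) * s = (1 + r * s) * (1 + l) by rewrite /r; field.
  by rewrite mulf_neq0.
have pE : p = c * ((1 - l) / ((1 + l) + (1 - l) * s)).
  by rewrite /p /r; field; rewrite l1 Qn0.
have p2 : p ^+ 2 = (1 - s) * (1 + s) * ((1 - l) / ((1 + l) + (1 - l) * s)) ^+ 2.
  by rewrite -c2 pE exprMn expr2.
have yn : 1 + y ^+ 2 = ((1 + s) + l ^+ 2 * (1 - s)) / ((1 - s) * l ^+ 2).
  by rewrite y2; field; rewrite s0 ln0.
have pn : 1 + p ^+ 2 = 2 * ((1 + s) + l ^+ 2 * (1 - s)) / ((1 + l) + (1 - l) * s) ^+ 2.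
  by rewrite p2; field.
split.
  have -> : c * (2 * p / (1 + p ^+ 2)) =
      2 * ((1 - s) * (1 + s) * ((1 - l) / ((1 + l) + (1 - l) * s))) / (1 + p ^+ 2).
    by rewrite -c2 pE; set d := 1 + _; ring.
  by rewrite yn pn y2 p2; field; rewrite s0 ln0 Dn0 Qn0.
rewrite yn pn p2 pE /y; field.
by rewrite s0 ln0 Dn0 Qn0.
Qed.

(** Half-angle change of variable: on the circle the phase of a Blaschke factor
    centred on the imaginary axis is [t] plus a smooth periodic function. *)
Lemma cis_2atan_circle (l t : R) : 0 < l -> sin t != 1 ->
  cis (2 * atan (cos t / (1 - sin t) / l)) = cis (t + pi / 2 + 2 * mobius_arg l t) :> C.
Proof.
move=> l0 s1; have r1 := mobius_coef_lt1 l0.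
have q0 : 0 < 1 + (1 - l) / (1 + l) * sin t.
  by apply: lt_le_trans (sin_gtN1 t r1); rewrite subr_gt0.
have sl : sin t < 1 by rewrite lt_neqAle s1 sin_le1.
have c2 : cos t * cos t = (1 - sin t) * (1 + sin t).
  by rewrite -expr2 cos2sin2; ring.
have [hc hs] := mobius_arg_identity l0 (sin_geN1 t) sl q0 c2.
rewrite /cis (addrAC t).
apply/eqP; rewrite eq_complex /=; apply/andP; split; apply/eqP.
  by rewrite cosDpihalf sinD cos_2atan hc /mobius_arg cos_2atan sin_2atan.
by rewrite sinDpihalf cosD sin_2atan hs /mobius_arg cos_2atan sin_2atan.
Qed.

(** The plateau at [x = cos t / (1 - sin t)], where
    [x^2 = (1 + sin t) / (1 - sin t)]; this form is smooth across the north
    pole. *)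
Definition circle_plateau (N : nat) (t : R) : R :=
  N%:R^-1 * \sum_(j < N) ((N%:R ^+ j) ^+ 2 * (1 - sin t) *
    ((1 + sin t) + (N%:R ^+ j) ^+ 2 * (1 - sin t))^-1).

Lemma circle_smooth_plateau N : circle_smooth (circle_plateau N.+1).
Proof.
have cs := @circle_smooth_sin R; have cc := @circle_smooth_cst R.
have s1 : circle_smooth (fun t : R => 1 - sin t).
  have := circle_smoothD (cc 1) (circle_smoothM (cc (-1)) cs).
  by under eq_fun do rewrite mulN1r.
apply: circle_smoothM; first exact: cc.
apply: circle_smooth_sum => j; apply: circle_smoothM.
  by apply: circle_smoothM; [exact: cc|exact: s1].
apply: (@circle_smoothV _ _ 2) => //.
  move=> t; have : 1 <= (N.+1%:R ^+ j) ^+ 2 :> R by rewrite !exprn_ege1// ler1n.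
  by have := sin_le1 t; set l := _ ^+ 2; nra.
by apply: circle_smoothD; [apply: circle_smoothD|apply: circle_smoothM].
Qed.

Lemma plateau_circle N t : sin t != 1 ->
  plateau N.+1 (cos t / (1 - sin t)) = circle_plateau N.+1 t :> R.
Proof.
move=> s1; congr (_ * _); apply: eq_bigr => j _.
have s0 : 1 - sin t != 0 by rewrite subr_eq0 eq_sym.
have l1 : 1 <= (N.+1%:R ^+ j) ^+ 2 :> R by rewrite !exprn_ege1// ler1n.
have D0 : (1 + sin t) + (N.+1%:R ^+ j) ^+ 2 * (1 - sin t) != 0.
  have := sin_le1 t; move: l1; set l := _ ^+ 2 => l1 st; rewrite gt_eqF//; nra.
have -> : (cos t / (1 - sin t)) ^+ 2 = (1 + sin t) / (1 - sin t).
  by rewrite expr_div_n cos2sin2; field.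
move: D0; set l := (_ ^+ j) ^+ 2 => D0; field.
by rewrite s0 D0.
Qed.

Definition circle_phase (L s : R) (N : nat) (t : R) : R :=
  2 * mobius_arg L^-1 t + 2 * mobius_arg L t + s * (pi * circle_plateau N t).

Lemma cis_uphase_circle L s N t : 0 < L -> sin t != 1 ->
  cis (uphase L s N.+1 (stereo_inv (cis t))) =
  cis (2 * t + pi + circle_phase L s N.+1 t) :> C.
Proof.
move=> L0 s1; rewrite /stereo_inv /= /uphase /bphase plateau_circle//.
rewrite (cisD (2 * atan _ + _)) (cisD (2 * atan _)).
rewrite !cis_2atan_circle ?invr_gt0// -!cisD /circle_phase; congr cis.
by move: (mobius_arg L^-1 t) (mobius_arg L t) (circle_plateau _ t) pi => a b c p; field.
Qed.

Lemma circle_smooth_phase L s N : 0 < L -> circle_smooth (circle_phase L s N.+1).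
Proof.
move=> L0; have cc := @circle_smooth_cst R.
apply: circle_smoothD; [apply: circle_smoothD|]; apply: circle_smoothM => //.
- by apply: circle_smooth_mobius_arg; rewrite invr_gt0.
- exact: circle_smooth_mobius_arg.
- by apply: circle_smoothM => //; exact: circle_smooth_plateau.
Qed.

End CircleLift.

(** * The degree of the candidate map *)

Section DegreeOfCandidate.
Context {R : realType}.
Local Notation mu := (@lebesgue_measure R).
Local Notation C := R[i].
Local Notation I := (`[0%R, (2 * pi)%R]%classic : set R).

(** The lift increases by [4 pi] over a period. *)
Lemma int_sum_double_phase (G : R -> R) : circle_smooth G ->
  int_sum (fun k => k%:~R * cabs (coef (fun t => cis (2 * t + pi + G t)) k) ^+ 2) = 2%:E :> \bar R.
Proof.
move=> [g [M [K [M0 K0 [dG cg] bG [pG lG]]]]].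
pose F t := 2 * t + pi + G t.
have dF (t : R) : is_derive t 1 F (2 + g t).
  have ? := dG t; apply: is_derive_eq.
  by rewrite /GRing.scale /= mulr1 addr0.
have cf : continuous (fun t => 2 + g t).
  by move=> t; apply: cvgD; [exact: cvg_cst|exact: cg].
have fM t : `|2 + g t| <= 2 + M.
  apply: le_trans (ler_normD _ _) _; rewrite ger0_norm// lerD2l.
  by have [] := bG t.
have K8 : 0 <= 8 + 2 * K by rewrite addr_ge0// mulr_ge0.
have ch s t : 2 - 2 * cos (F s - F t) <= (8 + 2 * K) ^+ 2 * (2 - 2 * cos (s - t)).
  have -> : F s - F t = ((s - t) + (s - t)) + (G s - G t) by rewrite /F; ring.
  apply: le_trans (chordD _ _) _.
  have h1 := chordD (s - t) (s - t).
  have h2 := le_trans (one_sub_cos_le (G s - G t)) (lG s t).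
  have c0 := chord_ge0 (s - t).
  move: h1 h2 c0; set c := 2 - 2 * cos (s - t); set d := 2 - _; set e := 2 - _.
  move=> h1 h2 c0; apply: (@le_trans _ _ ((8 + 2 * K) * c)); first by lra.
  by apply: ler_wpM2r => //; rewrite expr2 ler_peMr//; lra.
have diff : F (2 * pi) - F 0 = 2 * (2 * pi) by rewrite /F pG; ring.
have per : cis (F (2 * pi)) = cis (F 0) :> C.
  rewrite -(subrK (F 0) (F (2 * pi))) diff cisD.
  by have := @cis_2pi_int R 2; rewrite (_ : 2%:~R = 2)// => ->; rewrite mul1r.
apply: (@int_sum_modes _ _ _ (energy2 (fun t => (2 + g t)%:C * cis (F t)) / (2 * pi))).
  by move=> n; exact: (square_modes_bound dF cf fM).
have := weighted_modes_cvg dF cf fM ch K8 per.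
rewrite diff mulfK ?gt_eqF ?twopi_gt0// => H.
by rewrite -cvg_shiftS.
Qed.

Lemma sin_eq1_period (t : R) : t \in `[0, 2 * pi] -> sin t = 1 -> t = pi / 2.
Proof.
rewrite in_itv/= => /andP[t0 t2] s1.
have c0 : cos t = 0.
  by apply/eqP; rewrite -sqrf_eq0 cos2sin2 s1 expr1n subrr.
have p0 := pi_gt0 R.
have [tp|tp] := leP t pi.
  apply: cos_inj.
  - by rewrite in_itv/= t0 tp.
  - by rewrite in_itv/= divr_ge0 ?pi_ge0//= ler_pdivrMr//; lra.
  - by rewrite c0 cos_pihalf.
have : 0 <= sin (t - pi) by apply: sin_ge0_pi; apply/andP; split; lra.
rewrite sinB cospi sinpi s1; lra.
Qed.

(** The two integrands differ at most at the north pole [t = pi / 2]. *)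
Lemma fourier_coef_stereo (u : R -> C) (F : R -> R) k :
    cmeasurable u -> continuous F ->
    (forall t, sin t != 1 -> u (stereo_inv (cis t)) = cis (F t)) ->
  fourier_coef (fun z => u (stereo_inv z)) k = coef (fun t => cis (F t)) k.
Proof.
move=> mu_ cF uF; rewrite /fourier_coef /coef; congr (_ * _).
have mx : measurable_fun [set: R] (fun t : R => stereo_inv (cis t)).
  rewrite /stereo_inv /=; apply: measurable_funM.
    exact: continuous_measurable_fun (@continuous_cos R).
  apply: (measurableT_comp measurable_inv); apply: measurable_funB => //.
  exact: continuous_measurable_fun (@continuous_sin R).
have me : cmeasurable (fun t : R => cis (- (k%:~R * t)) : C).
  apply: cmeasurable_cis => t; apply: cvgN; apply: cvgMl_tmp; exact: cvg_id.
have m1 : cmeasurable (fun t => u (stereo_inv (cis t)) * cis (- (k%:~R * t))).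
  apply: cmeasurableM me; case: mu_ => a b.
  by split; [exact: (measurableT_comp a)|exact: (measurableT_comp b)].
have m2 : cmeasurable (fun t => cis (F t) * expi (- k) t).
  by apply: cmeasurableM; [exact: cmeasurable_cis|exact/cmeasurable_cis/continuous_linear].
have agree t : t != pi / 2 -> t \in I ->
    u (stereo_inv (cis t)) * cis (- (k%:~R * t)) = cis (F t) * expi (- k) t.
  move=> tn tI; rewrite uF ?/expi ?mulrNz ?mulNr//.
  by apply: contra tn => /eqP s1; apply/eqP; apply: sin_eq1_period => //; rewrite inE in tI.
have ae (f g : R -> R) : measurable_fun [set: R] f -> measurable_fun [set: R] g ->
    (forall t, t != pi / 2 -> t \in I -> f t = g t) -> Rintegral mu I f = Rintegral mu I g.
  move=> mf mg fg; rewrite /Rintegral; congr fine; apply: ae_eq_integral => //.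
  - by apply/measurable_EFinP; exact: measurable_funTS.
  - by apply/measurable_EFinP; exact: measurable_funTS.
  exists [set pi / 2]; split => //.
  - exact: lebesgue_measure_set1.
  - move=> t /= H; apply: contrapT => /eqP tn; apply: H => tI.
    by rewrite fg// inE.
rewrite /cintegral; case: m1 m2 => [m1 m1'] [m2 m2']; congr (_ +i* _).
  by apply: ae => // t tn tI; rewrite agree.
by apply: ae => // t tn tI; rewrite agree.
Qed.

Lemma deg_candidate (L s : R) N : 0 < L ->
  deg_line (fun x => cis (uphase L s N.+1 x)) = 2%:E.
Proof.
move=> L0; rewrite /deg_line /deg_circle.
have sm := circle_smooth_phase s N L0.
have cF : continuous (fun t : R => 2 * t + pi + circle_phase L s N.+1 t).
  case: sm => [g [M [K [_ _ [dG _] _ _]]]] t.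
  apply: cvgD; last exact: (derive_continuous dG).
  by apply: cvgD; [apply: cvgMl_tmp; exact: cvg_id|exact: cvg_cst].
rewrite -(int_sum_double_phase sm); congr int_sum; apply/funext => k.
rewrite (fourier_coef_stereo k (cmeasurable_cis (@continuous_uphase R L s N)) cF)//.
by move=> t s1; exact: cis_uphase_circle.
Qed.

End DegreeOfCandidate.

Theorem theorem1p4 (R : realType) (M : R) (hM : 0 < M) :
  exists u : R -> R[i],
    [/\ HhalfS u,
        deg_line u = 2%:E &
        (M%:E * (Hhalf_sqnorm u - 2%:E) <=
         ereal_inf [set s | exists (theta : R) (a : R[i] * R[i]),
           [/\ upper_half a.1, upper_half a.2 &
               s = Hhalf_sqnorm (fun x => u x - psi theta a x)%R]])%E].
Proof.
have [c c0 H] := @distance_lower_bound R.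
pose B := M * (2 * pi ^+ 2) / c.
have B0 : 0 <= B.
  by apply: divr_ge0; [apply: mulr_ge0; [exact: ltW|rewrite mulr_ge0 ?sqr_ge0]|exact: ltW].
pose N := Num.truncn B.
have NB : B < N.+1%:R by exact: truncnS_gt.
have [L L1 dist] := H N.
have [s [ss Es]] := exists_sign_energy N L1.
have L0 : 0 < L by apply: lt_trans L1.
exists (fun x => cis (uphase L s N.+1 x)); split.
- split.
  + exact/cmeasurable_cis/continuous_uphase.
  + apply: aeW => x; have := cabs_cis (uphase L s N.+1 x) => /eqP.
    by rewrite sqrp_eq1 => [/eqP //|]; exact: sqrtr_ge0.
  + exact: le_lt_trans Es (ltry _).
- exact: deg_candidate.
apply: le_ereal_inf_tmp => _ [theta [a [a1 a2 ->]]].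
apply: le_trans (dist s theta a ss a1 a2).
apply: (@le_trans _ _ (M%:E * (2 * pi ^+ 2 / N.+1%:R)%:E)%E).
  apply: lee_wpmul2l; first by rewrite lee_fin ltW.
  by rewrite leeBlDr// -EFinD addrC.
rewrite -EFinM lee_fin mulrA ler_pdivrMr// -ler_pdivrMl// mulrC.
exact: ltW.
Qed.
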